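(* Let $n\ge2$ and $\gamma\in\Gamma$. Then for almost every $s\in[0,\|\gamma\|]$, $$\frac{d}{ds}w_\gamma(s)\ \ge\ \min\{\Phi(S,u):\ S\in\mathcal{C},\ u\in S^*\}.$$ In particular the derivative of the mean width of the convex hull of $\gamma(s)$ is bounded below by a positive constant depending only on $n$.
   Context: $\Gamma$ is the family of rectifiable curves $\gamma\subset\mathbb{R}^n$ which, in arc-length parametrization $x(s)$, $s\in[0,\|\gamma\|]$ ($\|\gamma\|$ the length), satisfy for a.e. $s$: $\langle x'(s),x(s)-x(\sigma)\rangle\ge0$ for all $\sigma\le s$ (steepest descent curves). $\gamma(s)=\{x(\sigma):0\le\sigma\le s\}$, $co(E)$ is the convex hull of $E$, and $w_\gamma(s)=w(co(\gamma(s)))$, where the mean width of a convex body $K$ is $w(K)=\frac{2}{\omega_n}\int_{S^{n-1}}h_K(\theta)\,d\sigma(\theta)$, $h_K(\theta)=\sup_{y\in K}\langle\theta,y\rangle$, $\sigma$ the spherical Lebesgue measure and $\omega_n=2\pi^{n/2}/\Gamma(n/2)$. A sector is $N\cap S^{n-1}$ with $N$ a closed convex cone; $S^*=\{y\in S^{n-1}:\langle y,x\rangle\ge0\ \forall x\in S\}$; $\mathcal{C}$ is the class of sectors with $S\supseteq S^*$; $\Phi(S,u)=\frac{2}{\omega_n}\int_S\langle\theta,u\rangle\,d\sigma(\theta)$. *)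

(* Defs.v *)
From HB Require Import structures.
From mathcomp Require Import all_boot all_order all_algebra.
From mathcomp Require Import all_classical all_reals all_analysis.
Import Order.TTheory GRing.Theory Num.Theory.
Import numFieldNormedType.Exports.

Set Implicit Arguments.
Unset Strict Implicit.
Unset Printing Implicit Defensive.

Local Open Scope classical_set_scope.
Local Open Scope ring_scope.

Definition dotv {R : realType} {n : nat} (u v : 'rV[R]_n) : R :=
  \sum_(i < n) u ord0 i * v ord0 i.

Definition enorm {R : realType} {n : nat} (v : 'rV[R]_n) : R :=
  Num.sqrt (dotv v v).

Definition sphere (R : realType) (n : nat) : set 'rV[R]_n :=
  [set x | enorm x = 1].

(** Lebesgue integral over R^n, realized as the iterated (Fubini)
    integral of one-dimensional Lebesgue integrals (MathComp-Analysis has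
    no n-dimensional Lebesgue measure on 'rV[R]_n). *)
Fixpoint Rn_integral {R : realType} (n : nat) : ('rV[R]_n -> \bar R) -> \bar R :=
  match n with
  | 0 => fun g => g 0
  | n'.+1 => fun g =>
      (\int[@lebesgue_measure R]_(t in [set: R])
         Rn_integral (fun v : 'rV[R]_n' => g (row_mx (\row_(j < 1) t) v)))%E
  end.

Definition cone1 {R : realType} {n : nat} (A : set 'rV[R]_n) : set 'rV[R]_n :=
  [set x | 0 < enorm x <= 1 /\ A ((enorm x)^-1 *: x)].

(** Integral over A ⊆ S^{n-1} with respect to the spherical Lebesgue
    measure sigma, defined (as usual) through the n-dimensional Lebesgue
    measure by sigma(A) = n * lambda_n(cone1 A), i.e.
    int_A f dsigma = n * int_{cone1 A} f(x/|x|) dx. *)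
Definition sph_integral {R : realType} {n : nat} (A : set 'rV[R]_n)
  (f : 'rV[R]_n -> R) : R :=
  n%:R * fine (Rn_integral (fun x => (\1_(cone1 A) x * f ((enorm x)^-1 *: x))%:E)).

Definition Gamma {R : realType} (x : R) : R :=
  fine (\int[@lebesgue_measure R]_(t in [set t : R | (0 < t)%R])
          ((t `^ (x - 1)) * expR (- t))%R%:E)%E.

Definition omega (R : realType) (n : nat) : R :=
  2 * (pi `^ (n%:R / 2)) / Gamma (n%:R / 2).

Definition is_convex {R : realType} {n : nat} (C : set 'rV[R]_n) : Prop :=
  forall x y (t : R), C x -> C y -> 0 <= t <= 1 -> C (t *: x + (1 - t) *: y).

Definition conv_hull {R : realType} {n : nat} (E : set 'rV[R]_n) : set 'rV[R]_n :=
  [set y | forall C, is_convex C -> E `<=` C -> C y].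

Definition supp_fun {R : realType} {n : nat} (K : set 'rV[R]_n) (theta : 'rV[R]_n) : R :=
  sup [set dotv theta y | y in K].

Definition mean_width {R : realType} {n : nat} (K : set 'rV[R]_n) : R :=
  2 / @omega R n * sph_integral (@sphere R n) (supp_fun K).

Fixpoint poly_len {R : realType} {n : nat} (x : R -> 'rV[R]_n) (a : R) (s : seq R) : R :=
  match s with
  | [::] => 0
  | t :: s' => enorm (x t - x a) + poly_len x t s'
  end.

Definition curve_length {R : realType} {n : nat} (x : R -> 'rV[R]_n) (a b : R) : \bar R :=
  ereal_sup [set (poly_len x a s)%:E | s in
               [set s : seq R | path <=%R a s /\ last a s = b]].

Definition arclength_param {R : realType} {n : nat} (x : R -> 'rV[R]_n) (L : R) : Prop :=
  forall a b, 0 <= a -> a <= b -> b <= L -> curve_length x a b = (b - a)%:E.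

Definition steepest_descent {R : realType} {n : nat} (x : R -> 'rV[R]_n) (L : R) : Prop :=
  {ae @lebesgue_measure R, forall s, 0 <= s <= L ->
     derivable x s 1 /\
     forall sig, 0 <= sig <= s -> 0 <= dotv (derive1 x s) (x s - x sig)}.

Definition in_Gamma {R : realType} {n : nat} (x : R -> 'rV[R]_n) (L : R) : Prop :=
  0 <= L /\ arclength_param x L /\ steepest_descent x L.

Definition w_gamma {R : realType} {n : nat} (x : R -> 'rV[R]_n) (s : R) : R :=
  mean_width (conv_hull [set x sig | sig in `[0, s]%classic]).

Definition closed_convex_cone {R : realType} {n : nat} (N : set 'rV[R]_n) : Prop :=
  closed N /\ is_convex N /\ N 0 /\ (forall x (t : R), N x -> 0 <= t -> N (t *: x)).

Definition sector {R : realType} {n : nat} (S : set 'rV[R]_n) : Prop :=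
  exists N, closed_convex_cone N /\ S = N `&` @sphere R n.

Definition dual_sector {R : realType} {n : nat} (S : set 'rV[R]_n) : set 'rV[R]_n :=
  [set y | @sphere R n y /\ forall x, S x -> 0 <= dotv y x].

Definition classC {R : realType} {n : nat} (S : set 'rV[R]_n) : Prop :=
  sector S /\ dual_sector S `<=` S.

Definition Phi {R : realType} {n : nat} (S : set 'rV[R]_n) (u : 'rV[R]_n) : R :=
  2 / @omega R n * sph_integral S (fun theta => dotv theta u).

(* Main.v *)
Require Import Defs.
From HB Require Import structures.
From mathcomp Require Import all_boot all_order all_algebra.
From mathcomp Require Import all_classical all_reals all_analysis.
From mathcomp Require Import measurable_realfun ring lra.
Import Order.TTheory GRing.Theory Num.Theory.
Import numFieldNormedType.Exports.
Local Open Scope classical_set_scope.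
Local Open Scope ring_scope.

Set Implicit Arguments.
Unset Strict Implicit.
Unset Printing Implicit Defensive.

(** Let S be the set of unit normals of co(gamma(s)) at the point x(s).  For
    theta in S the support function at theta grows at least like <theta, x>, and
    elsewhere it does not decrease, so w' >= Phi(S, x'(s)).  The squared distances
    |x(s) - x(sigma)|^2 are nondecreasing in s, hence the chords x(s) - x(sigma)
    make pairwise acute angles; this says S* is contained in S, while x'(s) is in
    S* by differentiating along S, and |x'| = 1 a.e. because the length of gamma
    is the integral of |x'|.

    Every S in the class C contains the sector of directions making acute angles
    with all of A = S*, a closed acute subset of the sphere, so Phi need only be
    minimised over pairs (A, u) with u in A.  An ultrafilter of minimising pairs
    has a limit (A0, u0); the directions at angle bounded away from pi/2 from A0
    are eventually admissible, and the remaining boundary directions of A0 form a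
    null set, since infinitely many of its translates are disjoint. *)

(** * Euclidean geometry of row vectors and closed cones *)

(** The descent inequality holds only at almost every s. Each conclusion drawn from it along an
    interval (monotone distances, unit speed), and likewise the existence of w', therefore needs a
    Lipschitz function to be the integral of its derivative. Radon-Nikodym and the almost-everywhere
    fundamental theorem of calculus supply this. The limit in the minimisation need only be lower
    semicontinuous. A direction with margin e against the limit set keeps a nonnegative margin
    against every set lying within e of it, and the integrand is nonnegative on the sectors
    compared, so passing to a subsector only lowers the value. An ultrafilter takes the place of a
    selection theorem for sets: any choice of one point from each set converges along it, by
    compactness of the sphere. Spherical integrals are handled as volume integrals over solid cones,
    so the null boundary comes from translation invariance of Lebesgue measure. Factors 2^n are
    volumes of the cube of half-side 1 that contains these cones. *)

Lemma continuous_bigsum (R : realType) (T : topologicalType) I (r : seq I)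
    (f : I -> T -> R) :
  (forall i, continuous (f i)) -> continuous (fun v => \sum_(i <- r) f i v).
Proof.
move=> cf; elim: r => [|i r IH] v.
  rewrite (_ : (fun v => _) = cst 0); first exact: cvg_cst.
  by apply/funext => w; rewrite big_nil.
rewrite (_ : (fun v => _) = (fun v => f i v + \sum_(j <- r) f j v)).
  by apply: cvgD; [exact: cf|exact: IH].
by apply/funext => w; rewrite big_cons.
Qed.

Section Vectors.
Variables (R : realType) (n : nat).
Implicit Types u v w : 'rV[R]_n.

Lemma dotvC u v : dotv u v = dotv v u.
Proof. by apply: eq_bigr => i _; rewrite mulrC. Qed.

Lemma dotvDl u v w : dotv (u + v) w = dotv u w + dotv v w.
Proof. by rewrite /dotv -big_split; apply: eq_bigr => i _; rewrite !mxE mulrDl. Qed.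

Lemma dotvZl (c : R) u v : dotv (c *: u) v = c * dotv u v.
Proof. by rewrite /dotv mulr_sumr; apply: eq_bigr => i _; rewrite !mxE mulrA. Qed.

Lemma dotvDr u v w : dotv u (v + w) = dotv u v + dotv u w.
Proof. by rewrite dotvC dotvDl !(dotvC u). Qed.

Lemma dotvZr (c : R) u v : dotv u (c *: v) = c * dotv u v.
Proof. by rewrite dotvC dotvZl dotvC. Qed.

Lemma dotvNl u v : dotv (- u) v = - dotv u v.
Proof. by rewrite -scaleN1r dotvZl mulN1r. Qed.

Lemma dotvNr u v : dotv u (- v) = - dotv u v.
Proof. by rewrite dotvC dotvNl dotvC. Qed.

Lemma dotvBl u v w : dotv (u - v) w = dotv u w - dotv v w.
Proof. by rewrite dotvDl dotvNl. Qed.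

Lemma dotvBr u v w : dotv u (v - w) = dotv u v - dotv u w.
Proof. by rewrite dotvDr dotvNr. Qed.

Lemma dot0v u : dotv 0 u = 0.
Proof. by rewrite -(scale0r u) dotvZl mul0r. Qed.

Lemma dotv0 u : dotv u 0 = 0.
Proof. by rewrite dotvC dot0v. Qed.

Lemma dotv_sumr I (r : seq I) (P : pred I) u (F : I -> 'rV[R]_n) :
  dotv u (\sum_(i <- r | P i) F i) = \sum_(i <- r | P i) dotv u (F i).
Proof. exact: (big_morph _ (dotvDr u) (dotv0 u)). Qed.

Lemma dotvv_ge0 u : 0 <= dotv u u.
Proof. by apply: sumr_ge0 => i _; rewrite -expr2 sqr_ge0. Qed.

Lemma sqr_enorm u : enorm u ^+ 2 = dotv u u.
Proof. by rewrite sqr_sqrtr// dotvv_ge0. Qed.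

Lemma enorm_ge0 u : 0 <= enorm u. Proof. exact: sqrtr_ge0. Qed.

Lemma ler_coord_enorm u i : `|u ord0 i| <= enorm u.
Proof.
rewrite -sqrtr_sqr ler_sqrt ?dotvv_ge0// /dotv (bigD1 i)//= -expr2 lerDl.
by apply: sumr_ge0 => j _; rewrite -expr2 sqr_ge0.
Qed.

Lemma enorm_eq0 u : (enorm u == 0) = (u == 0).
Proof.
apply/eqP/eqP => [u0|->]; last by rewrite /enorm dotv0 sqrtr0.
apply/rowP => i; rewrite mxE; apply/eqP.
by rewrite -normr_le0 -u0 ler_coord_enorm.
Qed.

Lemma enorm0 : enorm (0 : 'rV[R]_n) = 0.
Proof. by apply/eqP; rewrite enorm_eq0. Qed.

Lemma enorm_gt0 u : (0 < enorm u) = (u != 0).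
Proof. by rewrite lt_neqAle enorm_ge0 andbT eq_sym enorm_eq0. Qed.

Lemma enormZ (c : R) u : enorm (c *: u) = `|c| * enorm u.
Proof.
by rewrite /enorm dotvZl dotvZr mulrA -expr2 sqrtrM ?sqr_ge0// sqrtr_sqr.
Qed.

Lemma enormN u : enorm (- u) = enorm u.
Proof. by rewrite -scaleN1r enormZ normrN1 mul1r. Qed.

Lemma enormB u v : enorm (u - v) = enorm (v - u).
Proof. by rewrite -enormN opprB. Qed.

Lemma enorm_normalize u : u != 0 -> enorm ((enorm u)^-1 *: u) = 1.
Proof.
rewrite -enorm_gt0 => u0.
by rewrite enormZ gtr0_norm ?invr_gt0// mulVf// gt_eqF.
Qed.

Lemma cauchy_schwarz u v : dotv u v <= enorm u * enorm v.
Proof.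
have [->|] := eqVneq u 0; first by rewrite dot0v enorm0 mul0r.
have [->|] := eqVneq v 0; first by rewrite dotv0 enorm0 mulr0.
rewrite -!enorm_gt0 => v0 u0.
have := dotvv_ge0 (enorm v *: u - enorm u *: v).
rewrite dotvBl !dotvBr !dotvZl !dotvZr -!sqr_enorm (dotvC v u) => H.
rewrite -(ler_pM2l (mulr_gt0 u0 v0)); lra.
Qed.

Lemma abs_cauchy_schwarz u v : `|dotv u v| <= enorm u * enorm v.
Proof.
by rewrite ler_norml cauchy_schwarz andbT lerNl -dotvNl -(enormN u) cauchy_schwarz.
Qed.

Lemma enormD u v : enorm (u + v) <= enorm u + enorm v.
Proof.
rewrite -(ler_pXn2r (ltn0Sn 1)) ?nnegrE ?addr_ge0 ?enorm_ge0//.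
rewrite sqrrD !sqr_enorm dotvDl !dotvDr (dotvC v u).
have := cauchy_schwarz u v; lra.
Qed.

Lemma enorm_sub u v w : enorm (u - w) <= enorm (u - v) + enorm (v - w).
Proof. by apply: le_trans (enormD _ _); rewrite addrA subrK. Qed.

Lemma enorm_le_sum u : enorm u <= \sum_(i < n) `|u ord0 i|.
Proof.
have S0 : 0 <= \sum_(i < n) `|u ord0 i| by apply: sumr_ge0.
rewrite -(ger0_norm S0) -sqrtr_sqr ler_sqrt ?sqr_ge0// expr2 mulr_suml.
apply: ler_sum => i _; rewrite -expr2 -real_normK ?num_real// expr2.
rewrite ler_wpM2l// (bigD1 i)//= lerDl; apply: sumr_ge0 => //.
Qed.

Lemma dotv_sphere u v : enorm u = 1 -> enorm v = 1 ->
  dotv u v = 1 - enorm (u - v) ^+ 2 / 2.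
Proof.
move=> u1 v1; rewrite sqr_enorm dotvBl !dotvBr -!sqr_enorm u1 v1 (dotvC v u).
by lra.
Qed.

Lemma continuous_dotv u : continuous (dotv u).
Proof.
apply: (@continuous_bigsum R _ _ _ (fun i v => u ord0 i * v ord0 i)) => i v.
apply: (@continuousM R 'rV[R]_n (cst (u ord0 i)) (fun v => v ord0 i) v).
  exact: cst_continuous.
exact: coord_continuous.
Qed.

Lemma continuous_dotvv : continuous (fun v : 'rV[R]_n => dotv v v).
Proof.
apply: (@continuous_bigsum R _ _ _ (fun i v => v ord0 i * v ord0 i)) => i v.
apply: (@continuousM R 'rV[R]_n (fun v => v ord0 i) (fun v => v ord0 i) v);
  exact: coord_continuous.
Qed.

Lemma continuous_enorm : continuous (@enorm R n).
Proof.
move=> v; apply: (@continuous_comp _ _ _ (fun v => dotv v v)).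
  exact: continuous_dotvv.
exact: sqrt_continuous.
Qed.

Lemma continuous_enormB u : continuous (fun z : 'rV[R]_n => enorm (z - u)).
Proof.
move=> z; apply: (@continuous_comp _ _ _ (fun z : 'rV[R]_n => z - u)).
  by apply: continuousB; [by move=> ?|exact: cst_continuous].
exact: continuous_enorm.
Qed.

Lemma compact_of_enorm_bound (A : set 'rV[R]_n) (M : R) :
  closed A -> (forall v, A v -> enorm v <= M) -> compact A.
Proof.
move=> cA AM.
apply: (subclosed_compact cA
  (@rV_compact _ n (fun=> `[-M, M]%classic) (fun=> @segment_compact _ _ _))).
move=> v /AM vM i /=; rewrite in_itv/= -ler_norml.
exact: le_trans (ler_coord_enorm _ _) vM.
Qed.

Lemma closed_sphere : closed (@sphere R n).
Proof.
have /continuous_closedP := continuous_enorm.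
by move=> /(_ _ (@closed_eq R 1)).
Qed.

End Vectors.

(** * Projection on closed convex cones, polarity and the class C *)

Section Cones.
Variables (R : realType) (n : nat).
Implicit Types (u v w y z p : 'rV[R]_n) (A N S : set 'rV[R]_n).

(** Moreau decomposition: p is the metric projection of y. It exists by compactness of the part of N
    no farther from y than the apex 0. Convexity gives the variational inequality at p, and
    invariance under scaling turns it into orthogonality. *)
Lemma nearest_point N y : closed_convex_cone N ->
  exists2 p, N p & forall z, N z -> dotv (y - p) z <= 0 /\ dotv (y - p) p = 0.
Proof.
move=> [cN [convN [N0 NZ]]].
pose K := N `&` [set z | enorm (z - y) <= enorm y].
have cont := @continuous_enormB R n y.
have cK : compact K.
  apply: (@compact_of_enorm_bound _ _ _ (enorm y + enorm y)).
    apply: closedI => //.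
    by move/continuous_closedP : cont => /(_ _ (@closed_le R (enorm y))).
  move=> z [_ /= zy]; rewrite -[z](subrK y).
  by apply: le_trans (enormD _ _) _; rewrite lerD2r.
have K0 : K !=set0 by exists 0; split => //=; rewrite sub0r enormN.
have [p /set_mem[Np py] pmin] := EVT_min_rV K0 cK (continuous_subspaceT cont).
have {}pmin z : N z -> enorm (p - y) <= enorm (z - y).
  move=> Nz; have [zy|/ltW yz] := leP (enorm (z - y)) (enorm y).
    by apply: pmin; apply/mem_set.
  exact: le_trans py yz.
have var z : N z -> dotv (y - p) (z - p) <= 0.
  move=> Nz; rewrite leNgt; apply/negP => pos.
  pose D := dotv (z - p) (z - p); pose d := dotv (y - p) (z - p).
  have D0 : 0 <= D by exact: dotvv_ge0.
  (* Moving from p towards z by t changes the squared distance to y by [t ^+ 2 * D - 2 * t * d],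
     which is negative once [t * D < d]. The summand 1 keeps the quotient meaningful when D = 0. *)
  pose t := Num.min 1 (d / (D + 1)).
  have t0 : 0 < t by rewrite lt_min ltr01 divr_gt0// ltr_wpDl.
  have t1 : t <= 1 by rewrite ge_min lexx.
  have tD : t * (D + 1) <= d.
    by rewrite -ler_pdivlMr ?ltr_wpDl// ge_min lexx orbT.
  have := pmin (t *: z + (1 - t) *: p) (convN _ _ _ Nz Np _).
  rewrite (ltW t0) t1 => /(_ isT).
  rewrite -(ler_pXn2r (ltn0Sn 1)) ?nnegrE ?enorm_ge0// !sqr_enorm.
  have -> : t *: z + (1 - t) *: p - y = t *: (z - p) - (y - p).
    by apply/rowP => i; rewrite !mxE; ring.
  have sq a b : dotv (t *: a - b) (t *: a - b) =
      t ^+ 2 * dotv a a - 2 * t * dotv b a + dotv b b.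
    by rewrite dotvBl !dotvBr !dotvZl !dotvZr (dotvC a b); ring.
  rewrite sq -/D -/d.
  have -> : dotv (p - y) (p - y) = dotv (y - p) (y - p).
    by rewrite -opprB dotvNl dotvNr opprK.
  have : t * D < d by apply: lt_le_trans tD; rewrite ltr_pM2l// ltrDl.
  rewrite -/d in pos; nra.
have e0 : dotv (y - p) p = 0.
  (* The variational inequality at [2 *: p] and at [0] gives the two signs. *)
  apply/eqP; rewrite eq_le; apply/andP; split.
    have := var _ (NZ _ 2 Np (ler0n _ _)).
    by rewrite scaler_nat mulr2n addrK.
  by have := var _ N0; rewrite sub0r dotvNr oppr_le0.
exists p => // z /var; rewrite dotvBr e0 subr0 => ?; by split.
Qed.

(** The sign is that of the dual cone. For A the set of chords [x s - x sig] it is the cone of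
    outward normals at [x s] of the hull of the past. *)
Definition polar_cone A : set 'rV[R]_n := [set z | forall a, A a -> 0 <= dotv z a].

Lemma polar_cone_ccc A : closed_convex_cone (polar_cone A).
Proof.
split.
  rewrite (_ : polar_cone A = \bigcap_(a in A) (dotv a @^-1` [set r | 0 <= r])).
    apply: closed_bigI => a _.
    by have /continuous_closedP := @continuous_dotv R n a; apply; exact: closed_ge.
  by apply/seteqP; split => z /= h a /h; rewrite dotvC.
split.
  move=> x y t Ax Ay /andP[t0 t1] a Aa.
  by rewrite dotvDl !dotvZl addr_ge0// mulr_ge0 ?Ax ?Ay ?subr_ge0.
split; first by move=> a _; rewrite dot0v.
by move=> x t Ax t0 a Aa; rewrite dotvZl mulr_ge0 ?Ax.
Qed.

Definition polar_sector A : set 'rV[R]_n := polar_cone A `&` @sphere R n.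

Definition acute A := forall a b, A a -> A b -> 0 <= dotv a b.

(* If p is the projection of y on N = polar_cone A then p - y pairs nonnegatively
   with A, because acuteness puts A inside N; so p - y is in N, and pairing it
   with y gives y = p. *)
Lemma polar_sector_classC A : acute A -> classC (polar_sector A).
Proof.
move=> acA; split; first by exists (polar_cone A); split => //; exact: polar_cone_ccc.
move=> y [y1 dy]; split => //.
have [p Np py] := nearest_point y (polar_cone_ccc A).
suff -> : y = p by [].
have Nq : polar_cone A (p - y).
  move=> a Aa; rewrite -opprB dotvNl oppr_ge0.
  apply: (py a _).1 => b Ab; exact: acA.
have : 0 <= dotv y (p - y).
  have [->|q0] := eqVneq (p - y) 0; first by rewrite dotv0.
  have /dy : polar_sector A ((enorm (p - y))^-1 *: (p - y)).
    split; last exact: enorm_normalize.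
    have [_ [_ [_ NZ]]] := polar_cone_ccc A.
    by apply: NZ => //; rewrite invr_ge0 enorm_ge0.
  by rewrite dotvZr pmulr_rge0// invr_gt0 enorm_gt0.
have := (py _ Np).2; rewrite dotvC dotvBr => e.
have -> : dotv y (p - y) = - dotv (p - y) (p - y).
  rewrite !dotvBl !dotvBr; move: e; rewrite (dotvC y p); lra.
rewrite oppr_ge0 -sqr_enorm => h.
have : enorm (p - y) ^+ 2 == 0 by rewrite eq_le h sqr_ge0.
by rewrite expf_eq0/= enorm_eq0 subr_eq0 => /eqP.
Qed.

(** If p is the projection of y on the cone of S, then p - y, normalised, lies in S*, so it pairs
    nonnegatively with y. Since p is orthogonal to p - y, that pairing is a negative multiple of |p
    - y|^2, which forces y = p. *)
Lemma bipolar S : sector S -> polar_sector (dual_sector S) `<=` S.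
Proof.
move=> [N [cN ->]] y [hy y1]; split => //.
have [_ [_ [_ NZ]]] := cN.
have [p Np py] := nearest_point y cN.
have [e|] := eqVneq p y; first by rewrite -e.
rewrite -subr_eq0 => q0.
have /hy : dual_sector (N `&` @sphere R n) ((enorm (p - y))^-1 *: (p - y)).
  split; first exact: enorm_normalize.
  move=> z [Nz _]; rewrite dotvZl mulr_ge0 ?invr_ge0 ?enorm_ge0//.
  by rewrite -opprB dotvNl oppr_ge0 (py _ Nz).1.
rewrite dotvZr pmulr_rge0 ?invr_gt0 ?enorm_gt0//.
have := (py _ Np).2; rewrite dotvC dotvBr => e.
have -> : dotv y (p - y) = - dotv (p - y) (p - y).
  rewrite !dotvBl !dotvBr; move: e; rewrite (dotvC y p); lra.
rewrite oppr_ge0 -sqr_enorm => h.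
have : enorm (p - y) ^+ 2 == 0 by rewrite eq_le h sqr_ge0.
by rewrite expf_eq0/= enorm_eq0 (negbTE q0).
Qed.

(** The inclusion of S* in S allows one element of S* to be tested against another. *)
Lemma acute_dual_sector S : classC S -> acute (dual_sector S).
Proof. by move=> [_ sub] a b [_ ha] /sub; exact: ha. Qed.

End Cones.

(** * Iterated Lebesgue integral on row vectors *)

Section SigmaFiniteProduct.
Context d1 d2 (T1 : measurableType d1) (T2 : measurableType d2) (R : realType).
Variables (m1 : {sigma_finite_measure set T1 -> \bar R})
  (m2 : {sigma_finite_measure set T2 -> \bar R}).

(* [product_measure1] itself only has a canonical sigma-finite structure for
   subprobabilities, hence this alias. *)
Definition sprod : set (T1 * T2) -> \bar R := (m1 \x m2)%E.

HB.instance Definition _ := Measure.on sprod.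

Lemma sprod_sigma_finite : sigma_finite setT sprod.
Proof.
have /sigma_finiteP[F [FT ndF Ffin]] := sigma_finiteT m1.
have /sigma_finiteP[G [GT ndG Gfin]] := sigma_finiteT m2.
exists (fun k => F k `*` G k) => [|k].
  apply/seteqP; split => // -[x y] _.
  have [i _ Fx] : (\bigcup_i F i) x by rewrite -FT.
  have [j _ Gy] : (\bigcup_i G i) y by rewrite -GT.
  exists (maxn i j) => //; split => /=.
    by move/subsetPset : (ndF _ _ (leq_maxl i j)); exact.
  by move/subsetPset : (ndG _ _ (leq_maxr i j)); exact.
have [[mF Flt] [mG Glt]] := (Ffin k, Gfin k).
split; first exact: measurableX.
by rewrite /sprod product_measure1E// lte_mul_pinfty// ge0_fin_numE.
Qed.

HB.instance Definition _ :=
  Measure_isSigmaFinite.Build _ _ _ sprod sprod_sigma_finite.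

End SigmaFiniteProduct.

(* [euclid R n] is R^n as the nested product R * (R * ... * unit), on which the
   iterated integral [Rn_integral] becomes a genuine integral by Fubini. *)
Record mspace (R : realType) := MSpace {
  ms_d : measure_display;
  ms_T : measurableType ms_d;
  ms_mu : {sigma_finite_measure set ms_T -> \bar R} }.

Fixpoint euclid (R : realType) (n : nat) : mspace R :=
  match n with
  | 0 => MSpace (\d_ tt : {sigma_finite_measure set unit -> \bar R})
  | n'.+1 => MSpace (sprod (@lebesgue_measure R) (ms_mu (euclid R n'))
      : {sigma_finite_measure set (_ * ms_T (euclid R n'))%type -> \bar R})
  end.

Fixpoint rv (R : realType) (n : nat) : ms_T (euclid R n) -> 'rV[R]_n :=
  match n with
  | 0 => fun=> 0
  | n'.+1 => fun p => row_mx (\row_(j < 1) p.1) (rv p.2)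
  end.

Section Lebesgue.
Variable R : realType.
Notation leb := (@lebesgue_measure R).
Notation mu n := (ms_mu (euclid R n)).

(** Cubes suit the recursion on the dimension: the preimage under [rv] splits as an interval times a
    smaller cube. *)
Definition box n (c : 'rV[R]_n) (r : R) : set 'rV[R]_n :=
  [set v | forall i, `|v ord0 i - c ord0 i| <= r].

Lemma row_mxE0 n (t : R) (v : 'rV[R]_n) :
  (row_mx (\row_(j < 1) t) v : 'rV[R]_n.+1) ord0 ord0 = t.
Proof.
rewrite mxE; case: splitP => j; first by rewrite mxE.
by move=> e; exfalso; move: e; rewrite /= add1n.
Qed.

Lemma row_mxES n (t : R) (v : 'rV[R]_n) i :
  (row_mx (\row_(j < 1) t) v : 'rV[R]_n.+1) ord0 (lift ord0 i) = v ord0 i.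
Proof.
rewrite mxE; case: splitP => j; first by move=> e; move: (ltn_ord j); rewrite -e.
by rewrite /= /bump/= => /eqP; rewrite eqn_add2l => /eqP/val_inj ->.
Qed.

Definition rtail n (v : 'rV[R]_n.+1) : 'rV[R]_n := \row_i v ord0 (lift ord0 i).

Lemma row_mx_head_tail n (v : 'rV[R]_n.+1) :
  row_mx (\row_(j < 1) v ord0 ord0) (rtail v) = v.
Proof.
apply/rowP => i; case: (unliftP ord0 i) => [j|] ->.
  by rewrite row_mxES mxE.
by rewrite row_mxE0.
Qed.

Lemma measurable_rv_coord n (i : 'I_n) :
  measurable_fun setT (fun p : ms_T (euclid R n) => rv p ord0 i).
Proof.
elim: n i => [[]//|n IH] i.
case: (unliftP ord0 i) => [j|] ->.
  rewrite (_ : (fun p => _) = (fun q => rv q ord0 j) \o snd); last first.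
    by apply/funext => p /=; rewrite row_mxES.
  by apply: measurableT_comp; [exact: IH|exact: measurable_snd].
rewrite (_ : (fun p => _) = fst); last first.
  by apply/funext => p /=; rewrite row_mxE0.
exact: measurable_fst.
Qed.

Lemma preimage_rv_box n (c : 'rV[R]_n.+1) r :
  @rv R n.+1 @^-1` box c r =
  `[c ord0 ord0 - r, c ord0 ord0 + r]%classic `*` (@rv R n @^-1` box (rtail c) r).
Proof.
apply/seteqP; split => -[t q] /=.
  move=> h; split.
    have := h ord0; rewrite row_mxE0 in_itv/= ler_norml; lra.
  by move=> i; have := h (lift ord0 i); rewrite row_mxES mxE.
move=> [/=]; rewrite in_itv/= => ht hq i.
case: (unliftP ord0 i) => [j|] ->.
  by rewrite row_mxES; have := hq j; rewrite mxE.
rewrite row_mxE0 ler_norml; lra.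
Qed.

Lemma measurable_box n (c : 'rV[R]_n) r : measurable (@rv R n @^-1` box c r).
Proof.
rewrite (_ : _ @^-1` _ = \bigcap_(i in [set: 'I_n])
    ((fun p => rv p ord0 i) @^-1` `[c ord0 i - r, c ord0 i + r]%classic)); last first.
  apply/seteqP; split => p /= h i => [_|].
    by have := h i; rewrite /= in_itv/= ler_norml; lra.
  by have := h i I; rewrite /= in_itv/= ler_norml; lra.
apply: fin_bigcap_measurable => [|i _]; first exact: finite_finset.
rewrite -[X in measurable X]setTI.
by apply: measurable_rv_coord => //; exact: measurable_itv.
Qed.

Lemma mu_box n (c : 'rV[R]_n) r : 0 <= r ->
  mu n (@rv R n @^-1` box c r) = ((2 * r) ^+ n)%:E.
Proof.
move=> r0; elim: n c => [c|n IH c].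
  rewrite expr0 (_ : _ @^-1` _ = setT); first by rewrite /= diracT.
  by apply/seteqP; split => // -[] _ /= [].
rewrite preimage_rv_box.
transitivity (leb `[(c ord0 ord0 - r)%R, (c ord0 ord0 + r)%R]%classic *
    mu n (@rv R n @^-1` box (rtail c) r))%E.
  by apply: product_measure1E; [exact: measurable_itv|exact: measurable_box].
rewrite IH lebesgue_measure_itv/= lte_fin exprS.
case: ltP => h; first by rewrite -EFinB -EFinM; congr (_ * _)%:E; lra.
have -> : r = 0 by lra.
by rewrite !mul0e mulr0 mul0r.
Qed.

Definition mfunRn n (g : 'rV[R]_n -> R) := measurable_fun setT (g \o @rv R n).

(* Bounded measurable functions of bounded support: unlike integrability, this is
   inherited by every section, not just almost every one. *)
Definition good n (g : 'rV[R]_n -> R) :=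
  mfunRn g /\ exists M r, [/\ 0 <= M, 0 <= r &
    forall v, `|g v| <= M * \1_(box 0 r) v].

Lemma good_integrable n (g : 'rV[R]_n -> R) : good g ->
  (mu n).-integrable setT (EFin \o g \o @rv R n).
Proof.
move=> [mg [M [r [M0 r0 gM]]]].
apply: (@le_integrable _ _ _ _ _ _ _
    (fun p => (M * \1_(@rv R n @^-1` box 0 r) p)%:E)) => //.
- exact/measurable_EFinP.
- move=> p _ /=; rewrite lee_fin (le_trans (gM _))// indicE.
  by rewrite ger0_norm ?mulr_ge0// ?indicE// .
apply: (eq_integrable _ (fun p => M%:E * (\1_(@rv R n @^-1` box 0 r) p)%:E)%E) => //.
apply: integrableZl => //.
apply/integrableP; split.
  by apply/measurable_EFinP; exact/measurable_indic/measurable_box.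
under eq_integral do rewrite gee0_abs ?lee_fin//.
rewrite integral_indic//; last exact: measurable_box.
rewrite setIT.
apply: (@le_lt_trans _ _ ((2 * r) ^+ n)%:E); last exact: ltry.
by rewrite -(mu_box 0 r0).
Qed.

Lemma good_section n (g : 'rV[R]_n.+1 -> R) t : good g ->
  good (fun v : 'rV[R]_n => g (row_mx (\row_(j < 1) t) v)).
Proof.
move=> [mg [M [r [M0 r0 gM]]]]; split.
  exact: (measurableT_comp mg (pair1_measurable t)).
exists M, r; split => // v; apply: le_trans (gM _) _.
rewrite ler_wpM2l// !indicE ler_nat.
case: (boolP ((row_mx (\row_(j < 1) t) v : 'rV[R]_n.+1) \in _)) => [/set_mem h|//].
rewrite (_ : v \in _ = true)//; apply/mem_set => i.
by have := h (lift ord0 i); rewrite row_mxES !mxE.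
Qed.

Lemma Rn_integralE n (g : 'rV[R]_n -> R) : good g ->
  Rn_integral (fun v => (g v)%:E) = (\int[mu n]_p (g (rv p))%:E)%E.
Proof.
elim: n g => [g gg|n IH g gg] /=.
  by rewrite integral_dirac//= diracT mul1e.
under eq_integral => t _ do rewrite (IH _ (good_section t gg)).
exact: (@integral12_prod_meas1 _ _ _ _ _ leb (mu n)
  (fun p => (g (row_mx (\row_(j < 1) p.1) (rv p.2)))%:E) (good_integrable gg)).
Qed.

Lemma measurable_Rn_section n (g : 'rV[R]_n.+1 -> R) : good g ->
  measurable_fun setT (fun t =>
    Rn_integral (fun v : 'rV[R]_n => (g (row_mx (\row_(j < 1) t) v))%:E)).
Proof.
move=> gg.
rewrite (_ : (fun t => _) = fun t =>
    (\int[mu n]_q (g (row_mx (\row_(j < 1) t) (rv q)))%:E)%E); last first.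
  by apply/funext => t; rewrite (Rn_integralE (good_section t gg)).
exact: (@measurable_fubini_F _ _ _ _ _ leb (mu n)
  (fun p => (g (row_mx (\row_(j < 1) p.1) (rv p.2)))%:E) (good_integrable gg)).
Qed.

End Lebesgue.

Section LebesgueTheory.
Variable R : realType.
Notation leb := (@lebesgue_measure R).
Notation mu n := (ms_mu (euclid R n)).

(** Measurability on row vectors is always expressed through [rv]. Lifting a vector-valued map by
    this section of [rv] lets it be checked one coordinate at a time. *)
Fixpoint vr (n : nat) : 'rV[R]_n -> ms_T (euclid R n) :=
  match n with
  | 0 => fun=> tt
  | n'.+1 => fun v => (v ord0 ord0, vr (rtail v))
  end.

Lemma vrK n : cancel (@vr n) (@rv R n).
Proof.
elim: n => [v|n IH v] /=; first by apply/rowP => -[].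
by rewrite IH row_mx_head_tail.
Qed.

Lemma measurable_vr d (X : measurableType d) n (T : X -> 'rV[R]_n) :
  (forall i, measurable_fun setT (fun p => T p ord0 i)) ->
  measurable_fun setT (fun p => vr (T p)).
Proof.
elim: n T => [T _|n IH T mT]; first exact: measurable_cst.
apply/measurable_fun_pairP; split; first exact: mT.
apply: (IH (fun p => rtail (T p))) => i.
rewrite (_ : (fun p => _) = fun p => T p ord0 (lift ord0 i))//.
by apply/funext => p; rewrite mxE.
Qed.

Lemma mfunRn_comp d (X : measurableType d) n (T : X -> 'rV[R]_n)
    (g : 'rV[R]_n -> R) :
  mfunRn g -> (forall i, measurable_fun setT (fun p => T p ord0 i)) ->
  measurable_fun setT (g \o T).
Proof.
move=> mg mT; rewrite (_ : g \o T = (g \o @rv R n) \o (fun p => vr (T p))).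
  exact: measurableT_comp mg (measurable_vr mT).
by apply/funext => p /=; rewrite vrK.
Qed.

(** An open set is the union of the countably many cubes with rational centre and half-side 1/(k+1)
    that it contains. *)
Lemma open_measurable_rv n (U : set 'rV[R]_n) : open U ->
  measurable (@rv R n @^-1` U).
Proof.
move=> oU.
pose F (x : 'rV[rat]_n * nat) : set (ms_T (euclid R n)) :=
  let B := box (map_mx ratr x.1) x.2.+1%:R^-1 in
  if `[< B `<=` U >] then @rv R n @^-1` B else set0.
rewrite (_ : _ @^-1` _ = \bigcup_x F x).
  apply: countable_bigcupT_measurable => [|x]; first exact: countableP.
  by rewrite /F; case: asboolP => _ //; exact: measurable_box.
apply/seteqP; split => p /=; last first.
  by move=> [x _]; rewrite /F; case: asboolP => // BU pB; exact: BU.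
move=> Up; move: oU; rewrite openE => /(_ _ Up) /nbhs_ballP[e /= e0 eU].
have [k ke] : exists k : nat, k.+1%:R^-1 < e / 2.
  have /cvgrPdist_lt := @cvg_harmonic R => /(_ (e / 2)).
  rewrite divr_gt0// => /(_ isT)[k _ /(_ k (leqnn _))] /=.
  by rewrite /harmonic/= sub0r normrN ger0_norm// => ?; exists k.
have k0 : 0 < k.+1%:R^-1 :> R by rewrite invr_gt0.
pose a : R := k.+1%:R^-1; rewrite -/a in ke k0.
have hq i : exists q : rat, `|rv p ord0 i - ratr q| < a.
  have /rat_in_itvoo[q] : rv p ord0 i - a < rv p ord0 i + a.
    by rewrite ltrBlDr -addrA ltrDl addr_gt0.
  rewrite in_itv/= => /andP[? ?]; exists q.
  by rewrite ltr_norml; apply/andP; split; lra.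
have [q hqq] := choice hq.
exists (\row_i q i, k) => //; rewrite /F.
have pB : box (map_mx ratr (\row_i q i)) a (rv p).
  by move=> i; rewrite !mxE ltW.
case: asboolP => [_|nB]; [exact: pB|apply: nB => v vB; apply: eU].
rewrite /ball/= /mx_ball; split => // i j; rewrite ord1 /ball/=.
have := vB j; have := pB j; rewrite !mxE -/a => h1 h2.
rewrite (_ : _ - _ = (rv p ord0 j - ratr (q j)) - (v ord0 j - ratr (q j))).
  apply: le_lt_trans (ler_normB _ _) _; lra.
by ring.
Qed.

Lemma closed_measurable_rv n (A : set 'rV[R]_n) : closed A ->
  measurable (@rv R n @^-1` A).
Proof.
move=> cA; rewrite -[X in measurable X]setCK; apply: measurableC.
by apply: (@open_measurable_rv _ (~` A)); rewrite openC.
Qed.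

Lemma continuous_mfunRn n (g : 'rV[R]_n -> R) : continuous g -> mfunRn g.
Proof.
move=> cg; apply: (measurability _ (RGenOInfty.measurableE R)).
move=> /= _ [_ [a ->]] <-; rewrite setTI comp_preimage.
apply: open_measurable_rv; move/continuousP : cg; apply.
exact: interval_open.
Qed.

Lemma mfunRn_indic n (A : set 'rV[R]_n) :
  measurable (@rv R n @^-1` A) -> mfunRn (\1_A : 'rV[R]_n -> R).
Proof.
move=> mA; rewrite /mfunRn (_ : _ \o _ = \1_(@rv R n @^-1` A)).
  exact: measurable_indic.
by apply/funext => p; rewrite /= !indicE.
Qed.

Definition Iint n (g : 'rV[R]_n -> R) : R :=
  (\int[mu n]_p (g (rv p)))%R.

Lemma fine_Rn_integral n (g : 'rV[R]_n -> R) : good g ->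
  fine (Rn_integral (fun v => (g v)%:E)) = Iint g.
Proof. by move=> gg; rewrite Rn_integralE. Qed.

Lemma goodZ n (g : 'rV[R]_n -> R) (c : R) : good g -> good (fun v => c * g v).
Proof.
move=> [mg [M [r [M0 r0 gM]]]]; split; first exact: measurable_funM.
exists (`|c| * M), r; split => // [|v]; first exact: mulr_ge0.
by rewrite normrM -mulrA ler_wpM2l.
Qed.

Lemma goodD n (f g : 'rV[R]_n -> R) : good f -> good g ->
  good (fun v => f v + g v).
Proof.
move=> [mf [M [r [M0 r0 fM]]]] [mg [N [s [N0 s0 gN]]]]; split.
  exact: measurable_funD.
exists (M + N), (r + s); split => [||v]; rewrite ?addr_ge0//.
apply: le_trans (ler_normD _ _) _; rewrite mulrDl; apply: lerD.
  apply: le_trans (fM v) _; rewrite ler_wpM2l// !indicE ler_nat.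
  case: (boolP (v \in box 0 r)) => [/set_mem h|//].
  by rewrite (_ : _ \in _ = true)//; apply/mem_set => i; have := h i; lra.
apply: le_trans (gN v) _; rewrite ler_wpM2l// !indicE ler_nat.
case: (boolP (v \in box 0 s)) => [/set_mem h|//].
by rewrite (_ : _ \in _ = true)//; apply/mem_set => i; have := h i; lra.
Qed.

Lemma goodB n (f g : 'rV[R]_n -> R) : good f -> good g ->
  good (fun v => f v - g v).
Proof.
move=> gf gg; rewrite (_ : (fun v => _) = fun v => f v + (-1) * g v).
  by apply: goodD => //; exact: goodZ.
by apply/funext => v; rewrite mulN1r.
Qed.

Lemma good_indic_box n (c : 'rV[R]_n) r : 0 <= r ->
  good (\1_(box c r) : 'rV[R]_n -> R).
Proof.
move=> r0; split; first exact/mfunRn_indic/measurable_box.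
exists 1, (r + enorm c); split => // [|v]; first by rewrite addr_ge0 ?enorm_ge0.
rewrite mul1r ger0_norm ?indicE// ler_nat.
case: (boolP (v \in box c r)) => [/set_mem h|//].
rewrite (_ : _ \in _ = true)//; apply/mem_set => i; rewrite mxE subr0.
rewrite -[v ord0 i](subrK (c ord0 i)); apply: le_trans (ler_normD _ _) _.
by rewrite lerD// ler_coord_enorm.
Qed.

Lemma Iint_box n (c : 'rV[R]_n) r : 0 <= r ->
  Iint (\1_(box c r) : 'rV[R]_n -> R) = (2 * r) ^+ n.
Proof.
move=> r0; rewrite /Iint /Rintegral.
under eq_integral => p _ do rewrite indicE.
have := @integral_indic _ _ _ (mu n) setT measurableT _ (measurable_box c r).
rewrite setIT => e; rewrite -[RHS]/(fine ((2 * r) ^+ n)%:E) -(mu_box c r0).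
congr fine; rewrite -e; apply: eq_integral => p _; rewrite indicE//.
Qed.

Lemma IintZ n (g : 'rV[R]_n -> R) (c : R) : good g ->
  Iint (fun v => c * g v) = c * Iint g.
Proof. by move=> gg; apply: RintegralZl => //; exact: good_integrable. Qed.

Lemma IintD n (f g : 'rV[R]_n -> R) : good f -> good g ->
  Iint (fun v => f v + g v) = Iint f + Iint g.
Proof. by move=> gf gg; apply: RintegralD => //; exact: good_integrable. Qed.

Lemma IintB n (f g : 'rV[R]_n -> R) : good f -> good g ->
  Iint (fun v => f v - g v) = Iint f - Iint g.
Proof. by move=> gf gg; apply: RintegralB => //; exact: good_integrable. Qed.

Lemma le_Iint n (f g : 'rV[R]_n -> R) : good f -> good g ->
  (forall v, f v <= g v) -> Iint f <= Iint g.
Proof.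
by move=> gf gg fg; apply: le_Rintegral => //; exact: good_integrable.
Qed.

Lemma eq_Iint n (f g : 'rV[R]_n -> R) : (forall v, f v = g v) -> Iint f = Iint g.
Proof. by move=> fg; apply: eq_Rintegral => p _; exact: fg. Qed.

Lemma Iint_gt0 n (g : 'rV[R]_n -> R) c (r e : R) : good g -> 0 < r -> 0 < e ->
  (forall v, 0 <= g v) -> (forall v, box c r v -> e <= g v) -> 0 < Iint g.
Proof.
move=> gg r0 e0 g0 ge.
apply: (@lt_le_trans _ _ (Iint (fun v => e * \1_(box c r) v))).
  rewrite IintZ ?Iint_box ?(ltW r0)//; last exact/good_indic_box/ltW.
  by rewrite mulr_gt0// exprn_gt0// mulr_gt0.
apply: le_Iint => // [|v]; first exact/goodZ/good_indic_box/ltW.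
rewrite indicE; case: (boolP (v \in _)) => [/set_mem/ge|_]; first by rewrite mulr1.
by rewrite mulr0.
Qed.

Lemma cvg_Iint n (f : nat -> 'rV[R]_n -> R) (g : 'rV[R]_n -> R) (M r : R) :
  (forall k, good (f k)) -> good g -> 0 <= M -> 0 <= r ->
  (forall k v, `|f k v| <= M * \1_(box 0 r) v) ->
  (forall v, f k v @[k --> \oo] --> g v) ->
  Iint (f k) @[k --> \oo] --> Iint g.
Proof.
move=> gf gg M0 r0 fM fg.
have gB : good (fun v : 'rV[R]_n => M * \1_(box 0 r) v).
  exact/goodZ/good_indic_box.
have [ig _ cv] := @dominated_convergence _ _ _ (mu n) setT measurableT
  (fun k p => (f k (rv p))%:E) (fun p => (g (rv p))%:E)
  (fun p => (M * \1_(box 0 r) (rv p))%:E)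
  (fun k => measurable_int _ (good_integrable (gf k)))
  (measurable_int _ (good_integrable gg))
  ltac:(by apply: aeW => p _; apply: cvg_EFin; [exact: nearW|exact: fg])
  (good_integrable gB) ltac:(by apply: aeW => p k _; rewrite lee_fin).
apply: fine_cvg; rewrite fineK//; exact: integrable_fin_num.
Qed.

End LebesgueTheory.

(** * Translation invariance, and null sets that meet each line of a direction at most once *)

Section Translation.
Variable R : realType.
Notation leb := (@lebesgue_measure R).

(** Lebesgue measure is determined by its values on half-open intervals, and the shifted measure has
    the same ones. *)
Lemma lebesgue_measure_shift (c : R) (A : set R) : measurable A ->
  pushforward leb (fun t : measurableTypeR R => t + c : measurableTypeR R) A = leb A.
Proof.
have ms : measurable_fun [set: measurableTypeR R]
    (fun t : measurableTypeR R => t + c : measurableTypeR R).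
  exact: measurable_funD.
pose f : {mfun measurableTypeR R >-> measurableTypeR R} :=
  HB.pack (fun t : measurableTypeR R => t + c : measurableTypeR R)
    (isMeasurableFun.Build _ _ _ _ _ ms).
move=> mA; apply/esym.
apply: (@lebesgue_measure_unique R (pushforward leb f)) => //= _ [[a b]] _ <-.
rewrite /pushforward/=.
rewrite (_ : _ @^-1` _ = `](a - c), (b - c)]%classic); last first.
  by apply/seteqP; split => t /=; rewrite !in_itv/= ltrBlDr lerBrDr.
rewrite !lebesgue_measure_itv/= !lte_fin ltrD2r.
by case: ifPn => // _; rewrite -!EFinB; congr (_%:E); ring.
Qed.

Lemma ge0_integral_shift (c : R) (G : R -> \bar R) :
  measurable_fun setT G -> (forall t, (0 <= G t)%E) ->
  (\int[leb]_t G (t + c)%R = \int[leb]_t G t)%E.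
Proof.
move=> mG G0.
have ms : measurable_fun [set: measurableTypeR R]
    (fun t : measurableTypeR R => t + c : measurableTypeR R).
  exact: measurable_funD.
rewrite -(ge0_integral_pushforward ms leb measurableT mG)//.
by apply: eq_measure_integral => A mA _; exact: lebesgue_measure_shift.
Qed.

Lemma good_shift n (g : 'rV[R]_n -> R) c : good g -> good (fun v => g (v + c)).
Proof.
move=> [mg [M [r [M0 r0 gM]]]]; split.
  apply: (mfunRn_comp (T := fun p => rv p + c) mg) => i.
  rewrite (_ : (fun p => _) = (fun p => rv p ord0 i + c ord0 i)).
    by apply: measurable_funD => //; exact: measurable_rv_coord.
  by apply/funext => p; rewrite mxE.
exists M, (r + enorm c); split; rewrite ?addr_ge0 ?enorm_ge0// => v.
apply: le_trans (gM _) _; rewrite ler_wpM2l// !indicE ler_nat.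
case: (boolP (v + c \in _)) => [/set_mem h|//].
rewrite (_ : v \in _ = true)//; apply/mem_set => i.
have := h i; have := ler_coord_enorm c i; rewrite !mxE !subr0 => h1 h2.
rewrite -[v ord0 i](addrK (c ord0 i)); apply: le_trans (ler_normB _ _) _.
exact: lerD.
Qed.

Lemma Rn_integral_ge0 n (g : 'rV[R]_n -> \bar R) :
  (forall v, (0 <= g v)%E) -> (0 <= Rn_integral g)%E.
Proof.
elim: n g => [|n IH] g g0 //=; apply: integral_ge0 => t _.
by apply: IH => v; exact: g0.
Qed.

(** The first coordinate is shifted by the one-dimensional statement for nonnegative functions, the
    others by induction on each section. *)
Lemma Rn_integral_shift n (g : 'rV[R]_n -> R) c : good g ->
  (forall v, 0 <= g v) ->
  Rn_integral (fun v => (g (v + c))%:E) = Rn_integral (fun v => (g v)%:E).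
Proof.
elim: n g c => [|n IH] g c gg g0 /=.
  by congr ((g _)%:E); apply/rowP => -[].
pose G t := Rn_integral (fun v : 'rV[R]_n => (g (row_mx (\row_(j < 1) t) v))%:E).
rewrite -[RHS](@ge0_integral_shift (c ord0 ord0) G); last 2 first.
- exact: measurable_Rn_section.
- by move=> t; apply: Rn_integral_ge0 => v; rewrite lee_fin.
apply: eq_integral => t _; rewrite /G.
rewrite -(IH _ (rtail c) (good_section (t + c ord0 ord0) gg))//.
congr Rn_integral; apply/funext => v; congr ((g _)%:E).
apply/rowP => i; rewrite [LHS]mxE; case: (unliftP ord0 i) => [j|] ->.
  by rewrite !row_mxES !mxE.
by rewrite !row_mxE0.
Qed.

Lemma Iint_shift n (g : 'rV[R]_n -> R) c : good g -> (forall v, 0 <= g v) ->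
  Iint (fun v => g (v + c)) = Iint g.
Proof.
move=> gg g0; rewrite -!fine_Rn_integral//; last exact: good_shift.
by rewrite Rn_integral_shift.
Qed.

Lemma Iint0 n : Iint (fun _ : 'rV[R]_n => 0) = 0.
Proof. by rewrite /Iint /Rintegral integral0. Qed.

Lemma good0 n : good (fun _ : 'rV[R]_n => 0).
Proof.
split; first exact: measurable_cst.
by exists 0, 0; split => // v; rewrite normr0 mul0r.
Qed.

Lemma Iint_sum n (f : nat -> 'rV[R]_n -> R) m : (forall k, good (f k)) ->
  good (fun v => \sum_(k < m) f k v) /\
  Iint (fun v => \sum_(k < m) f k v) = \sum_(k < m) Iint (f k).
Proof.
move=> gf; elim: m => [|m [gm IH]].
  rewrite (_ : (fun v => _) = fun=> 0).
    by rewrite big_ord0 Iint0; split => //; exact: good0.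
  by apply/funext => v; rewrite big_ord0.
rewrite (_ : (fun v => _) = fun v => \sum_(k < m) f k v + f m v).
  by split; [exact: goodD|rewrite IintD// IH big_ord_recr].
by apply/funext => v; rewrite big_ord_recr.
Qed.

(* Infinitely many disjoint translates of E along p, all of the same measure,
   fit into a bounded box. *)
Lemma Iint_transversal n (E : set 'rV[R]_n) (r : R) (p : 'rV[R]_n) :
  measurable (@rv R n @^-1` E) -> 0 <= r -> E `<=` box 0 r ->
  (forall v s t, E (v + s *: p) -> E (v + t *: p) -> s = t) ->
  Iint (\1_E : 'rV[R]_n -> R) = 0.
Proof.
move=> mE r0 Er line.
have gE : good (\1_E : 'rV[R]_n -> R).
  split; first exact: mfunRn_indic.
  exists 1, r; split => // v; rewrite mul1r ger0_norm ?indicE// ler_nat.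
  case: (boolP (v \in E)) => [/set_mem/Er h|//].
  by rewrite (_ : v \in _ = true)//; exact/mem_set.
have E0 v : 0 <= (\1_E v : R) by rewrite indicE.
(* The steps p/(k+1) are distinct multiples of p of norm at most |p|, so every translate stays in
   the cube of half-side [r + enorm p]. *)
pose c k := k.+1%:R^-1 *: p.
pose f k v : R := \1_E (v + c k).
have gf k : good (f k) by exact: good_shift.
pose r' := r + enorm p.
have r'0 : 0 <= r' by rewrite addr_ge0 ?enorm_ge0.
have le1 m : m%:R * Iint (\1_E : 'rV[R]_n -> R) <= (2 * r') ^+ n.
  rewrite -(Iint_box (0 : 'rV[R]_n) r'0).
  have [gs es] := Iint_sum m gf.
  have -> : m%:R * Iint (\1_E : 'rV[R]_n -> R) = Iint (fun v => \sum_(k < m) f k v).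
    rewrite es (eq_bigr (fun=> Iint (\1_E : 'rV[R]_n -> R))).
      by rewrite sumr_const card_ord mulr_natl.
    by move=> k _; exact: Iint_shift.
  apply: le_Iint => //; first exact: good_indic_box.
  move=> v; have [[k fk]|nf] := pselect (exists k : 'I_m, E (v + c k)).
    rewrite (bigD1 k)//= [X in _ + X]big1 => [|j jk]; last first.
      rewrite /f indicE; case: (boolP (_ \in E)) => [/set_mem fj|//].
      have /invr_inj/eqP := line _ _ _ fj fk.
      rewrite eqr_nat eqSS => /eqP/val_inj/eqP.
      by rewrite (negbTE jk).
    rewrite addr0 /f !indicE (_ : v \in _ = true) ?ler_nat ?leq_b1//.
    apply/mem_set => i; have := Er _ fk i; rewrite !mxE !subr0 => h.
    rewrite -[v ord0 i](addrK (k.+1%:R^-1 * p ord0 i)).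
    apply: le_trans (ler_normB _ _) _; apply: lerD => //.
    rewrite normrM; apply: le_trans (ler_coord_enorm p i).
    by rewrite ler_piMl// ger0_norm// invf_le1// ler1n.
  rewrite big1 ?indicE// => k _; rewrite /f indicE.
  by case: (boolP (_ \in E)) => [/set_mem ?|//]; case: nf; exists k.
apply/eqP; rewrite eq_le; apply/andP; split; last first.
  by rewrite -(Iint0 n); apply: le_Iint => //; exact: good0.
rewrite leNgt; apply/negP => a0.
set a := Iint _ in a0 le1.
have := le1 (Num.bound ((2 * r') ^+ n / a)).
have := archi_boundP (divr_ge0 (exprn_ge0 n (mulr_ge0 (ler0n _ 2) r'0)) (ltW a0)).
rewrite ltr_pdivrMr// => h1 h2.
by have := lt_le_trans h1 h2; rewrite ltxx.
Qed.

End Translation.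

(** * Integration over spherical sectors *)

Section GammaPos.
Variable R : realType.
Notation leb := (@lebesgue_measure R).

(* [ln t <= t / (2 a) + ln (2 a)] absorbs the power of [t] into [expR (t / 2)]. *)
Lemma Gamma_integrand_le (a t : R) : 1 <= a -> 0 < t ->
  t `^ (a - 1) * expR (- t) <=
  (2 * expR ((a - 1) * ln (2 * a))) * exponential_pdf 2^-1 t.
Proof.
move=> a1 t0; rewrite exponential_pdfE ?(ltW t0)//.
rewrite (_ : 2 * _ * _ = expR ((a - 1) * ln (2 * a)) * expR (- 2^-1 * t)); last first.
  by field.
rewrite /powR gt_eqF// -!expRD ler_expR.
have a0 : 0 < 2 * a by lra.
have : ln t <= t / (2 * a) + ln (2 * a).
  rewrite -[in leLHS](divfK (lt0r_neq0 a0) t) [leLHS]lnM ?posrE ?divr_gt0//.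
  by rewrite lerD2r ltW// ln_sublinear// divr_gt0.
have : (a - 1) * (t / (2 * a)) <= t / 2.
  rewrite mulrA ler_pdivrMr// ; nra.
move=> h1 h2; have : 0 <= a - 1 by lra.
move=> /ler_wpM2l/(_ _ _ h2); rewrite mulrDr; lra.
Qed.

(** [fine] sends an infinite integral to 0, so finiteness is part of the claim; it follows by
    comparison with an exponential density. Positivity comes from the interval [1, 2], where the
    integrand is at least exp(-2). *)
Lemma Gamma_gt0 (a : R) : 1 <= a -> 0 < Gamma a.
Proof.
move=> a1; pose D := [set t : R | 0 < t].
have mD : measurable D.
  by rewrite (_ : D = `]0, +oo[%classic) //; apply/seteqP; split => t;
    rewrite /D/= in_itv/= andbT.
pose g (t : R) := t `^ (a - 1) * expR (- t).
have mg : measurable_fun D g.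
  apply: measurable_funTS; apply: measurable_funM; first exact: measurable_powR.
  by apply: measurableT_comp => //; exact: measurable_funN.
have g0 t : 0 <= g t by rewrite mulr_ge0 ?powR_ge0 ?expR_ge0.
have ig : leb.-integrable D (EFin \o g).
  pose C := 2 * expR ((a - 1) * ln (2 * a)).
  have C0 : 0 <= C by rewrite mulr_ge0 ?expR_ge0.
  apply: (@le_integrable _ _ _ leb D mD (EFin \o g)
    (fun t => (C%:E * (exponential_pdf 2^-1 t)%:E)%E)).
  - exact/measurable_EFinP.
  - move=> t Dt /=; rewrite lee_fin !ger0_norm ?mulr_ge0 ?exponential_pdf_ge0 ?expR_ge0 ?powR_ge0//.
    exact: Gamma_integrand_le.
  - apply: integrableZl => //; apply: (@integrableS _ _ _ _ setT) => //.
    by apply: integrable_exponential_pdf; rewrite ?invr_gt0 ?invr_ge0.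
have fin : (\int[leb]_(t in D) (g t)%:E)%E \is a fin_num by exact: integrable_fin_num.
rewrite /Gamma fine_gt0//; apply/andP; split; last first.
  have I0 : (0 <= \int[leb]_(t in D) (g t)%:E)%E.
    by apply: integral_ge0 => t _; rewrite lee_fin.
  by move: fin; rewrite (ge0_fin_numE I0).
pose e : R := expR (- 2).
apply: (@lt_le_trans _ _ (\int[leb]_(t in `[1%R, 2%R]) (e%:E))%E).
  rewrite integral_cst//= lebesgue_measure_itv/= lte_fin ltr1n -EFinB.
  by rewrite mule_gt0// ?lte_fin ?expR_gt0// subr_gt0 ltr1n.
apply: (@le_trans _ _ (\int[leb]_(t in `[1%R, 2%R]) (g t)%:E)%E).
  apply: ge0_le_integral => //.
  - by move=> t _; rewrite lee_fin expR_ge0.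
  - apply/measurable_EFinP; apply: (@measurable_funS _ _ _ _ D) => // t /=.
    by rewrite in_itv/= /D/= => /andP[t1 _]; exact: (lt_le_trans ltr01 t1).
  - move=> t /=; rewrite in_itv/= => /andP[t1 t2]; rewrite lee_fin /g /e.
    rewrite -[leLHS]mul1r ler_pM ?expR_ge0// ?ler_expR ?lerN2//.
    by apply: (@le_trans _ _ (t `^ 0)); [rewrite powRr0|apply: ler_powR => //; lra].
apply: ge0_subset_integral => //.
- by apply/measurable_EFinP.
- by move=> t _; rewrite lee_fin.
- by move=> t /=; rewrite in_itv/= /D/= => /andP[t1 _]; exact: (lt_le_trans ltr01 t1).
Qed.

Lemma omega_gt0 n : (2 <= n)%N -> 0 < @omega R n.
Proof.
move=> n2; rewrite divr_gt0 ?mulr_gt0 ?powR_gt0 ?pi_gt0//.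
by apply: Gamma_gt0; rewrite ler_pdivlMr// mul1r ler_nat.
Qed.

End GammaPos.

(** * Spherical integrals as volume integrals over solid cones *)

Section SphereIntegral.
Variables (R : realType) (n : nat).
Implicit Types (A S : set 'rV[R]_n) (f : 'rV[R]_n -> R) (u v : 'rV[R]_n).

Definition sphfun A f (x : 'rV[R]_n) : R :=
  \1_(cone1 A) x * f ((enorm x)^-1 *: x).

Lemma cone1_box A : cone1 A `<=` box 0 1.
Proof.
move=> x [/andP[_ x1] _] i; rewrite mxE subr0.
exact: le_trans (ler_coord_enorm _ _) x1.
Qed.

Lemma measurable_enorm_rv :
  measurable_fun setT (fun p : ms_T (euclid R n) => enorm (rv p)).
Proof. by apply: continuous_mfunRn; exact: continuous_enorm. Qed.

Lemma measurable_normalize i : measurable_fun setT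
  (fun p : ms_T (euclid R n) => ((enorm (rv p))^-1 *: rv p) ord0 i).
Proof.
rewrite (_ : (fun p => _) = (fun p => enorm (rv p) `^ (-1) * rv p ord0 i)).
  apply: measurable_funM; last exact: measurable_rv_coord.
  exact: (measurableT_comp (@measurable_powR R (-1)) measurable_enorm_rv).
by apply/funext => p; rewrite mxE powR_inv1 ?enorm_ge0.
Qed.

Lemma measurable_cone1 A : closed A -> measurable (@rv R n @^-1` cone1 A).
Proof.
move=> cA.
rewrite (_ : _ @^-1` _ =
    ((fun p => enorm (rv p)) @^-1` `]0, 1]%classic) `&`
    ((fun p => vr ((enorm (rv p))^-1 *: rv p)) @^-1` (@rv R n @^-1` A))).
  apply: measurableI.
    by rewrite -[X in measurable X]setTI; apply: measurable_enorm_rv.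
  rewrite -[X in measurable X]setTI.
  apply: (measurable_vr measurable_normalize) => //.
  exact: closed_measurable_rv.
by apply/seteqP; split => p /=; rewrite vrK in_itv/= => -[].
Qed.

Lemma good_sphfun A f M : closed A -> continuous f -> 0 <= M ->
  (forall v, enorm v = 1 -> A v -> `|f v| <= M) -> good (sphfun A f).
Proof.
move=> cA cf M0 fM; split.
  apply: measurable_funM.
    exact: (mfunRn_indic (measurable_cone1 cA)).
  exact: (mfunRn_comp (continuous_mfunRn cf) measurable_normalize).
exists M, 1; split => // x; rewrite /sphfun normrM !indicE.
case: (boolP (x \in cone1 A)) => [/set_mem cx|_].
  rewrite (_ : x \in _ = true); last exact/mem_set/(cone1_box cx).
  rewrite normr1 mul1r mulr1; case: cx => /andP[x0 _] Ax.
  by apply: fM => //; rewrite enorm_normalize// -enorm_gt0.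
by rewrite normr0 mul0r mulr_ge0.
Qed.

Lemma sph_integralE A f : good (sphfun A f) ->
  sph_integral A f = n%:R * Iint (sphfun A f).
Proof. by move=> gf; rewrite -fine_Rn_integral. Qed.

Definition moment S v : R := Iint (sphfun S (fun th => dotv th v)).

Lemma continuous_dotvl v : continuous (fun th : 'rV[R]_n => dotv th v).
Proof.
rewrite (_ : (fun th => _) = dotv v); first exact: continuous_dotv.
by apply/funext => th; rewrite dotvC.
Qed.

Lemma good_moment S v : closed S -> good (sphfun S (fun th => dotv th v)).
Proof.
move=> cS; apply: (good_sphfun cS (@continuous_dotvl v) (enorm_ge0 v)).
by move=> th th1 _; rewrite (le_trans (abs_cauchy_schwarz _ _))// th1 mul1r.
Qed.

Lemma PhiE S v : closed S -> Phi S v = 2 / @omega R n * n%:R * moment S v.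
Proof.
move=> cS; rewrite /Phi sph_integralE ?mulrA//; exact: good_moment.
Qed.

Lemma momentB S u v : closed S -> moment S (u - v) = moment S u - moment S v.
Proof.
move=> cS; rewrite /moment -IintB; [|exact: good_moment|exact: good_moment].
by apply: eq_Iint => x; rewrite /sphfun dotvBr mulrBr.
Qed.

Lemma momentZ S c v : closed S -> moment S (c *: v) = c * moment S v.
Proof.
move=> cS; rewrite /moment -IintZ; last exact: good_moment.
by apply: eq_Iint => x; rewrite /sphfun dotvZr mulrCA.
Qed.

(** The factor is the volume of the cube that contains every [cone1 S]. With linearity in v this
    gives continuity of the moment, uniformly in S. *)
Lemma le_moment_norm S v : closed S -> moment S v <= 2 ^+ n * enorm v.
Proof.
move=> cS; rewrite -(mulr1 2) -(Iint_box (0 : 'rV[R]_n) ler01) mulrC -IintZ; last first.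
  exact: good_indic_box.
apply: le_Iint; first exact: good_moment.
  exact/goodZ/good_indic_box.
move=> x; rewrite /sphfun !indicE.
case: (boolP (x \in cone1 S)) => [/set_mem cx|_].
  rewrite (_ : x \in _ = true); last exact/mem_set/(cone1_box cx).
  rewrite mul1r mulr1; case: cx => /andP[x0 _] Sx.
  by rewrite (le_trans (cauchy_schwarz _ _))// enorm_normalize ?mul1r// -enorm_gt0.
by rewrite mul0r mulr_ge0 ?enorm_ge0.
Qed.

Lemma sector_closed S : sector S -> closed S.
Proof. by move=> [N [[cN _] ->]]; apply: closedI => //; exact: closed_sphere. Qed.

Lemma classC_closed S : classC S -> closed S.
Proof. by move=> [/sector_closed]. Qed.

End SphereIntegral.

(** * Existence of the minimum of Phi *)

Section Minimization.
Variables (R : realType) (n : nat).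
Implicit Types (A S : set 'rV[R]_n) (u v y : 'rV[R]_n).

Lemma open_eball y (e : R) : open [set z | enorm (z - y) < e].
Proof.
have /continuousP := @continuous_enormB R n y.
by move=> /(_ [set r | r < e]); apply; exact: open_lt.
Qed.

Lemma nbhs_eball y (e : R) : 0 < e -> nbhs y [set z | enorm (z - y) < e].
Proof.
move=> e0; apply: open_nbhs_nbhs; split; first exact: open_eball.
by rewrite /= subrr enorm0.
Qed.

Lemma compact_sphere : compact (@sphere R n).
Proof.
apply: (@compact_of_enorm_bound _ _ _ 1); first exact: closed_sphere.
by move=> v ->.
Qed.

(** A cluster point of the image filter is already a limit: if the preimage of a neighbourhood B
    were not in G, that of its complement would be, and the complement would have to meet B. *)
Lemma ultra_compact_cvg (T : Type) (G : set_system T) (X : topologicalType)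
    (K : set X) (f : T -> X) : UltraFilter G -> compact K -> G (f @^-1` K) ->
  exists2 p, K p & forall B, nbhs p B -> G (f @^-1` B).
Proof.
move=> UG cK GK.
have [p [Kp clp]] := cK (f @ G) _ GK.
exists p => // B Bp.
have [//|GC] := in_ultra_setVsetC (f @^-1` B) UG.
have [z [nBz Bz]] := clp (~` B) B GC Bp.
by [].
Qed.

(** The first component plays the role of S*, the second that of u; [polar_sector] gives the sector
    back. *)
Definition admissible (q : set 'rV[R]_n * 'rV[R]_n) :=
  [/\ q.1 `<=` @sphere R n, acute q.1 & q.1 q.2].

Definition cost (q : set 'rV[R]_n * 'rV[R]_n) : R := moment (polar_sector q.1) q.2.

Lemma closed_polar_sector A : closed (polar_sector A).
Proof. by apply: closedI; [exact: (polar_cone_ccc A).1|exact: closed_sphere]. Qed.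

(** The directions gained contribute nonnegatively. This is the only comparison between different
    sectors in the minimisation. *)
Lemma le_moment S S' u : closed S -> closed S' -> S `<=` S' ->
  (forall th, S' th -> 0 <= dotv th u) -> moment S u <= moment S' u.
Proof.
move=> cS cS' SS' pos; apply: le_Iint; [exact: good_moment|exact: good_moment|].
move=> x; rewrite /sphfun !indicE.
case: (boolP (x \in cone1 S)) => [/set_mem [x0 Sx]|_].
  by rewrite (_ : x \in _ = true)//; apply/mem_set; split => //; exact: SS'.
rewrite mul0r.
case: (boolP (x \in cone1 S')) => [/set_mem [_ Sx]|_]; rewrite ?mul1r ?mul0r//.
exact: pos.
Qed.

Lemma cost_ge0 q : admissible q -> 0 <= cost q.
Proof.
move=> [_ _ qq]; rewrite -(Iint0 R n); apply: le_Iint; first exact: good0.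
  exact/good_moment/closed_polar_sector.
move=> x; rewrite /sphfun !indicE.
case: (boolP (x \in cone1 (polar_sector q.1))) => [/set_mem [_ [Sx _]]|_]; rewrite ?mul1r ?mul0r//.
exact: Sx.
Qed.

(* p is the sum of a finite net of A: acuteness makes all the terms of <p, y>
   nonnegative, and the one closest to y contributes at least 1/2. *)
Lemma acute_interior A : closed A -> A `<=` @sphere R n -> acute A ->
  exists p, forall y, A y -> 2^-1 <= dotv p y.
Proof.
move=> cA As acA.
have : cover_compact A.
  by rewrite -compact_cover; apply: subclosed_compact As => //; exact: compact_sphere.
move=> /(_ _ A (fun y => [set z | enorm (z - y) < 1])).
case=> [y _|y Ay|D DA cov]; first exact: open_eball.
  by exists y => //=; rewrite subrr enorm0.
exists (\sum_(y <- finmap.enum_fset D) y) => z Az.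
have [y /= Dy zy] := cov _ Az.
rewrite dotvC dotv_sumr (big_rem y)//=.
have Ay : A y by have := DA _ Dy; rewrite inE.
rewrite -[leLHS]addr0 lerD//; last first.
  by rewrite big_seq sumr_ge0// => w /mem_rem/DA; rewrite inE => /(acA _ _ Az).
rewrite (dotv_sphere (As _ Az) (As _ Ay)).
have := enorm_ge0 (z - y); nra.
Qed.

(** An inner approximation of [polar_sector A] that survives perturbation: it lies in
    [polar_sector B] as soon as every point of B is within e of a point of A. *)
Definition deep_sector A (e : R) : set 'rV[R]_n :=
  @sphere R n `&` [set th | forall y, A y -> e <= dotv th y].

Lemma closed_deep_sector A e : closed (deep_sector A e).
Proof.
apply: closedI; first exact: closed_sphere.
rewrite (_ : mkset _ = \bigcap_(y in A) (dotv y @^-1` [set r | e <= r])).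
  apply: closed_bigI => y _.
  by have /continuous_closedP := @continuous_dotv R n y; apply; exact: closed_ge.
by apply/seteqP; split => th /= h y /h; rewrite dotvC.
Qed.

(** Along the direction p of [acute_interior] every pairing with A grows at rate at least 1/2.
    Beyond its first point in the polar cone, a line parallel to p has positive margin and lies in
    deep sectors, so it meets the boundary at most once. *)
Lemma Iint_sector_boundary A : closed A -> A `<=` @sphere R n -> acute A ->
  Iint (\1_(cone1 (polar_sector A) `\`
    \bigcup_k cone1 (deep_sector A k.+1%:R^-1)) : 'rV[R]_n -> R) = 0.
Proof.
move=> cA As acA; have [p pA] := acute_interior cA As acA.
apply: (@Iint_transversal R n _ 1 p) => //.
- rewrite (_ : _ @^-1` _ = (@rv R n @^-1` cone1 (polar_sector A)) `\`
      \bigcup_k (@rv R n @^-1` cone1 (deep_sector A k.+1%:R^-1)))//.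
  apply: measurableD; first exact/measurable_cone1/closed_polar_sector.
  by apply: bigcup_measurable => k _; exact/measurable_cone1/closed_deep_sector.
- by move=> x [+ _]; exact: cone1_box.
suff lt v s t : s < t -> (cone1 (polar_sector A) `\`
    \bigcup_k cone1 (deep_sector A k.+1%:R^-1)) (v + s *: p) ->
    (cone1 (polar_sector A) `\`
    \bigcup_k cone1 (deep_sector A k.+1%:R^-1)) (v + t *: p) -> False.
  move=> v s t Es Et; have [st|ts|//] := ltgtP s t.
    by case: (lt _ _ _ st Es Et).
  by case: (lt _ _ _ ts Et Es).
move=> st [[/andP[x0 x1] [xs _]] _] [[/andP[z0 z1] [_ zn]] nz].
apply: nz.
have ts0 : 0 < (t - s) / 2 by rewrite divr_gt0 ?subr_gt0.
(* The choice makes 1/(k+1) at most (t - s)/2, the margin gained between the two points. Normalising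
   a vector of norm at most 1 can only increase a positive margin. *)
pose k := Num.bound ((t - s) / 2)^-1; exists k => //; split; first by rewrite z0.
split=> // y Ay; rewrite dotvZl mulrC ler_pdivlMr//.
apply: (@le_trans _ _ ((t - s) / 2)).
  apply: (@le_trans _ _ k.+1%:R^-1); first by rewrite ler_piMr// invr_ge0.
  rewrite -[leRHS]invrK lef_pV2 ?posrE// ?invr_gt0//.
  apply/ltW/(lt_le_trans (archi_boundP _)); first by rewrite invr_ge0 ltW.
  by rewrite ler_nat.
have -> : v + t *: p = (v + s *: p) + (t - s) *: p.
  by apply/rowP => i; rewrite !mxE; ring.
rewrite dotvDl dotvZl -[leLHS]add0r lerD//.
  have := xs _ Ay; rewrite dotvZl pmulr_rge0// invr_gt0//.
by rewrite ler_wpM2l ?pA// subr_ge0 ltW.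
Qed.

(** The integrand over the polar sector minus that over the k-th deep sector tends pointwise to the
    integrand over the boundary E, a null set; the indicator of the unit cube dominates. *)
Lemma cvg_moment_deep A u : closed A -> A `<=` @sphere R n -> acute A -> A u ->
  moment (deep_sector A k.+1%:R^-1) u @[k --> \oo] --> moment (polar_sector A) u.
Proof.
move=> cA As acA Au.
set P := polar_sector A; pose S k := deep_sector A k.+1%:R^-1.
have gP : good (sphfun P (fun th => dotv th u)).
  exact/good_moment/closed_polar_sector.
have gS k : good (sphfun (S k) (fun th => dotv th u)).
  exact/good_moment/closed_deep_sector.
set E := cone1 P `\` \bigcup_k cone1 (S k).
have mE : measurable (@rv R n @^-1` E).
  rewrite (_ : _ @^-1` _ = (@rv R n @^-1` cone1 P) `\`
      \bigcup_k (@rv R n @^-1` cone1 (S k)))//.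
  apply: measurableD; first exact/measurable_cone1/closed_polar_sector.
  by apply: bigcup_measurable => k _; exact/measurable_cone1/closed_deep_sector.
pose f k x := sphfun P (fun th => dotv th u) x - sphfun (S k) (fun th => dotv th u) x.
pose g x : R := \1_E x * sphfun P (fun th => dotv th u) x.
have SP k : S k `<=` P.
  move=> th [th1 h]; split => // y /h; apply: le_trans.
  by rewrite invr_ge0.
have cs x : cone1 P x -> 0 <= dotv ((enorm x)^-1 *: x) u <= 1.
  move=> [/andP[x0 x1] [Px Px1]]; rewrite Px//=.
  by rewrite (le_trans (cauchy_schwarz _ _))// Px1 (As _ Au) mulr1.
have gg : good g.
  case: gP => mP [M [r [M0 r0 PM]]]; split.
    by apply: measurable_funM; [exact: (mfunRn_indic mE)|exact: mP].
  exists M, r; split => // x; apply: le_trans (PM x); rewrite /g normrM indicE.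
  by case: (_ \in _); rewrite ?normr1 ?mul1r// normr0 mul0r.
have g0 : Iint g = 0.
  have E0 := Iint_sector_boundary cA As acA.
  have gE : good (\1_E : 'rV[R]_n -> R).
    split; first exact: mfunRn_indic.
    exists 1, 1; split => // x; rewrite mul1r ger0_norm ?indicE// ler_nat.
    case: (boolP (x \in E)) => [/set_mem [/cone1_box h _]|//].
    by rewrite (_ : x \in _ = true)//; exact/mem_set.
  apply/eqP; rewrite eq_le; apply/andP; split.
    rewrite -E0; apply: le_Iint => // x; rewrite /g /sphfun !indicE.
    case: (boolP (x \in E)) => [/set_mem [cx _]|_]; last by rewrite mul0r.
    by rewrite (mem_set cx) !mul1r; case/andP : (cs _ cx).
  rewrite -(Iint0 R n); apply: le_Iint => //; first exact: good0.
  move=> x; rewrite /g /sphfun !indicE.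
  case: (boolP (x \in cone1 P)) => [/set_mem cx|_]; last by rewrite mul0r mulr0.
  by rewrite mul1r mulr_ge0//; case/andP : (cs _ cx).
have : Iint (f k) @[k --> \oo] --> Iint g.
  apply: (@cvg_Iint R n f g 1 1) => //.
  - by move=> k; exact: goodB.
  - move=> k x; rewrite /f /sphfun !indicE.
    case: (boolP (x \in cone1 P)) => [/set_mem cx|nPx].
      rewrite (_ : x \in box _ _ = true); last exact/mem_set/(cone1_box cx).
      have /andP[c0 c1] := cs _ cx.
      by case: (_ \in cone1 (S k)); rewrite !mul1r ?mul0r ?subrr ?subr0 ?normr0 ?ger0_norm//.
    have -> : x \in cone1 (S k) = false.
      apply/negbTE; apply: contra nPx => /set_mem[h /SP hx].
      by apply/mem_set; split.
    by rewrite mul0r subrr normr0 mulr_ge0.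
  move=> x; have [[k0 Sk]|nS] := pselect (exists k, cone1 (S k) x).
    have Px : cone1 P x by case: Sk => h /SP ?; split.
    (* Deep sectors increase with k, so from [k0] on [f k x] equals [g x], both being 0. *)
    apply: cvg_near_cst; near=> k.
    have Skx : cone1 (S k) x.
      case: Sk => h [h1 h2]; split => //; split => // y /h2; apply: le_trans.
      rewrite lef_pV2 ?posrE// ler_nat ltnS; near: k; exact: nbhs_infty_ge.
    rewrite /f /g /sphfun !indicE (mem_set Px) (mem_set Skx) subrr.
    rewrite memNset ?mul0r// => -[_]; apply; by exists k.
  rewrite (_ : (fun k => f k x) = fun=> g x); first exact: cvg_cst.
  apply/funext => k; rewrite /f /g /sphfun !indicE.
  have -> : x \in cone1 (S k) = false.
    by apply: memNset => h; apply: nS; exists k.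
  rewrite mul0r subr0; case: (boolP (x \in cone1 P)) => [/set_mem Px|_].
    rewrite (_ : x \in E = true) ?mul1r//; apply/mem_set; split => //.
    by move=> [k' _ ?]; apply: nS; exists k'.
  by rewrite mul0r mulr0.
rewrite g0 => cf.
have -> : moment (polar_sector A) u = moment P u - 0 by rewrite subr0.
rewrite (_ : (fun k => _) = (fun k => moment P u - Iint (f k))).
  by apply: cvgB => //; exact: cvg_cst.
by apply/funext => k; rewrite IintB// opprB addrC subrK.
Unshelve. all: by end_near. Qed.

End Minimization.

Section Minimizer.
Variables (R : realType) (n : nat).
Notation pair := (set 'rV[R]_n * 'rV[R]_n)%type.

(** The solid cone contains a cube on which the integrand is bounded below. Its centre c is the
    vector p of [acute_interior] rescaled to norm 1/2, and e = 1/(4|p|) is the resulting lower bound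
    for the pairing of c with A. *)
Lemma cost_gt0 (q : pair) : (0 < n)%N -> closed q.1 -> admissible q -> 0 < cost q.
Proof.
move=> n0 cA [As acA qq]; have [p pA] := acute_interior cA As acA.
have pu := pA _ qq; set u := q.2 in qq pu.
have np : 2^-1 <= enorm p.
  by rewrite (le_trans pu)// (le_trans (cauchy_schwarz _ _))// (As _ qq) mulr1.
have p0 : 0 < enorm p by apply: lt_le_trans np; rewrite invr_gt0.
pose e : R := (4 * enorm p)^-1.
have e0 : 0 < e by rewrite invr_gt0 mulr_gt0.
have e1 : e <= 2^-1 by rewrite lef_pV2 ?posrE ?mulr_gt0//; lra.
pose c := (2 * enorm p)^-1 *: p.
have c1 : enorm c = 2^-1.
  rewrite enormZ gtr0_norm ?invr_gt0 ?mulr_gt0//.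
  by rewrite invfM -mulrA mulVf ?mulr1// gt_eqF.
have cy y : q.1 y -> e <= dotv c y.
  move=> /pA h; rewrite dotvZl /e.
  have -> : (4 * enorm p)^-1 = (2 * enorm p)^-1 * 2^-1 by field; rewrite gt_eqF.
  by rewrite ler_wpM2l// invr_ge0 mulr_ge0// ltW.
have n0' : 0 < n%:R :> R by rewrite ltr0n.
(* With this half-side the cube lies in the Euclidean ball of radius e/2 about c, so half of the
   margin e remains and norms stay below 1. *)
pose r := e / 2 / n%:R.
have r0 : 0 < r by rewrite !divr_gt0.
have key x : box c r x -> enorm (x - c) <= e / 2.
  move=> h; apply: le_trans (enorm_le_sum _) _.
  apply: (@le_trans _ _ (\sum_(i < n) r)).
    by apply: ler_sum => i _; have := h i; rewrite !mxE.
  by rewrite sumr_const card_ord -[leLHS]mulr_natr divfK// gt_eqF.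
have cS := @closed_polar_sector R n q.1.
apply: (@Iint_gt0 R n _ c r (e / 2)) => //; first exact: good_moment.
- by rewrite divr_gt0.
- move=> x; rewrite /sphfun indicE.
  case: (boolP (x \in cone1 (polar_sector q.1))) => [/set_mem [_ [Sx _]]|_]; last by rewrite mul0r.
  by rewrite mul1r; exact: Sx.
move=> x /key xc.
have xy y : q.1 y -> e / 2 <= dotv x y.
  move=> qy; have := cy _ qy; have -> : x = c + (x - c) by rewrite addrC subrK.
  rewrite dotvDl; have := abs_cauchy_schwarz (x - c) y.
  rewrite (As _ qy) mulr1 ler_norml => /andP[h1 h2]; lra.
have x1 : enorm x <= 1.
  rewrite -[x](subrK c); apply: le_trans (enormD _ _) _; rewrite c1; lra.
have x0 : 0 < enorm x.
  have := xy _ qq; have := cauchy_schwarz x u; rewrite (As _ qq) mulr1; lra.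
have cx : cone1 (polar_sector q.1) x.
  split; first by rewrite x0.
  split; last by apply: enorm_normalize; rewrite -enorm_gt0.
  by move=> y /xy h; rewrite dotvZl mulr_ge0 ?invr_ge0 ?enorm_ge0//; lra.
rewrite /sphfun indicE (mem_set cx) mul1r dotvZl.
have hu := xy _ qq; apply: (le_trans hu).
by rewrite -[leLHS]mul1r ler_wpM2r ?invf_ge1//; lra.
Qed.

(** * Limits of admissible pairs along an ultrafilter *)

Section UltraLimit.
Variables (G : set_system pair) (UG : UltraFilter G).
Hypothesis Gadm : G (@admissible R n).

Let PG : ProperFilter G := ultra_proper.

Let GI P Q : G P -> G Q -> G (P `&` Q).
Proof. exact: filterI. Qed.

Let Gex P : G P -> exists q, P q.
Proof. exact: filter_ex. Qed.

(** The Kuratowski limit of the sets [q.1] along G. *)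
Definition limit_set : set 'rV[R]_n := @sphere R n `&`
  [set y | forall e, 0 < e -> G [set q | exists2 a, q.1 a & enorm (a - y) < e]].

Lemma acute_limit_set : acute limit_set.
Proof.
move=> a b [a1 ha] [b1 hb]; rewrite leNgt; apply/negP => ab0.
(* Replacing a and b by unit vectors closer than e raises the pairing by less than 2e, hence leaves
   it negative. *)
pose e := - dotv a b / 2.
have e0 : 0 < e by rewrite divr_gt0// oppr_gt0.
have /Gex[q [[[a' qa' aa'] [b' qb' bb']] [qs acq _]]] :=
  GI (GI (ha e e0) (hb e e0)) Gadm.
have := acq _ _ qa' qb'.
have -> : dotv a' b' = dotv a b + dotv (a' - a) b' + dotv a (b' - b).
  by rewrite dotvBl dotvBr; ring.
have := cauchy_schwarz (a' - a) b'; have := cauchy_schwarz a (b' - b).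
rewrite (qs _ qb') (a1 : enorm a = 1) mulr1 mul1r /e in aa' bb' *; lra.
Qed.

Lemma closed_limit_set : closed limit_set.
Proof.
apply: closedI; first exact: closed_sphere.
move=> y cly e e0; have e20 : 0 < e / 2 by rewrite divr_gt0.
have [z [hz /= zy]] := cly _ (nbhs_eball y e20).
apply: filterS (hz _ e20) => q [a qa az]; exists a => //.
apply: le_lt_trans (enorm_sub a z y) _; lra.
Qed.

Lemma ultra_sphere_cvg (f : pair -> 'rV[R]_n) : G [set q | @sphere R n (f q)] ->
  exists2 y, @sphere R n y & forall e, 0 < e -> G [set q | enorm (f q - y) < e].
Proof.
move=> Gf; have [y y1 hy] := ultra_compact_cvg UG (@compact_sphere R n) Gf.
by exists y => // e e0; exact: hy (nbhs_eball y e0).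
Qed.

(** The uniform half of Hausdorff convergence. Otherwise G-almost every [q.1] has a point at
    distance at least e from the limit set; these points converge along G, and their limit belongs
    to the limit set by definition. *)
Lemma near_limit_set (e : R) : 0 < e ->
  G [set q | forall a, q.1 a -> exists2 y, limit_set y & enorm (a - y) < e].
Proof.
move=> e0; set Q := [set q | _].
have [//|GQ] := in_ultra_setVsetC Q UG.
(* The choice must be total, so pairs already in Q receive the dummy value 0. *)
have hf (q : pair) : exists a, ~ Q q ->
    q.1 a /\ forall y, limit_set y -> e <= enorm (a - y).
  have [Qq|nQ] := pselect (Q q); first by exists 0.
  have [a ha] : exists a, ~ (q.1 a -> exists2 y, limit_set y & enorm (a - y) < e).
    by apply/existsNP.
  exists a => _; split; first by apply: contrapT => na; apply: ha.
  by move=> y ly; rewrite leNgt; apply/negP => ay; apply: ha => _; exists y.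
have [f ff] := choice hf.
have Gf : G [set q | @sphere R n (f q)].
  apply: filterS (GI GQ Gadm) => q [nQ [qs _ _]]; apply: qs.
  exact: (ff _ nQ).1.
have [y y1 hy] := ultra_sphere_cvg Gf.
have ly : limit_set y.
  split=> // e' e'0; apply: filterS (GI GQ (hy _ e'0)) => q [nQ fq].
  by exists (f q) => //; exact: (ff _ nQ).1.
have /Gex[q [nQ fq]] := GI GQ (hy _ e0).
by have := (ff _ nQ).2 _ ly; rewrite leNgt fq.
Qed.

(** Lower semicontinuity of the cost. For fixed k the deep sector of the limit set lies in the polar
    sector of G-almost every q, so its moment at u is at most [cost q] plus an error from [q.2]
    being near u. Then k tends to infinity. *)
Lemma limit_set_cost (m : R) :
  (forall e, 0 < e -> G [set q | cost q < m + e]) ->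
  exists u, admissible (limit_set, u) /\ cost (limit_set, u) <= m.
Proof.
move=> Gm.
have Gsnd : G [set q | @sphere R n q.2].
  by apply: filterS Gadm => q [qs _ qq]; exact: qs.
have [u u1 hu] := ultra_sphere_cvg Gsnd; exists u.
have lu : limit_set u.
  split=> // e e0; apply: filterS (GI Gadm (hu _ e0)) => q [[_ _ qq] qu].
  by exists q.2.
split; first by split; [by move=> ? []|exact: acute_limit_set|].
have sub : limit_set `<=` @sphere R n by move=> ? [].
have cv := cvg_moment_deep closed_limit_set sub acute_limit_set lu.
apply: (cvgr_to_le cv); apply: nearW => k; apply/ler_addgt0Pr => d d0.
pose S := deep_sector limit_set k.+1%:R^-1.
have cS : closed S by exact: closed_deep_sector.
(* Chosen so that [le_moment_norm] makes the error from replacing u by [q.2] at most d/2. *)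
pose d' := d / 2 / 2 ^+ n.
have d'0 : 0 < d' by rewrite !divr_gt0// exprn_gt0.
have k0 : 0 < k.+1%:R^-1 :> R by rewrite invr_gt0.
have d20 : 0 < d / 2 by rewrite divr_gt0.
have /Gex[q [[[qn [qs acq qq]] qu] qm]] := GI (GI (GI
  (near_limit_set k0) Gadm) (hu _ d'0)) (Gm _ d20).
have h1 : moment S q.2 <= cost q.
  apply: le_moment => //; first exact: closed_polar_sector.
    move=> th [th1 hth]; split => // a qa.
    have [y ly ay] := qn _ qa.
    have := hth _ ly; have := abs_cauchy_schwarz th (a - y).
    rewrite (th1 : enorm th = 1) mul1r ler_norml dotvBr => /andP[h1 h2] /= h3.
    set t := k.+1%:R^-1 in ay h3; lra.
  by move=> th [hth _]; exact: hth.
have h2 : moment S u - moment S q.2 <= d / 2.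
  rewrite -momentB//; apply: le_trans (le_moment_norm _ cS) _.
  rewrite enormB mulrC -ler_pdivlMr ?exprn_gt0// ltW//; exact: qu.
rewrite /= in qm; lra.
Qed.

End UltraLimit.

(** The sets of pairs with cost within e of the infimum generate a proper filter; the limit along an
    ultrafilter refining it attains the infimum. *)
Lemma cost_minimizer : (0 < n)%N -> exists q : pair,
  [/\ admissible q, closed q.1 & forall q' : pair, admissible q' -> cost q <= cost q'].
Proof.
move=> n0; pose V := [set @cost R n q | q in @admissible R n].
have infV : has_inf V.
  split; last by exists 0 => _ [q aq <-]; exact: cost_ge0.
  pose d : 'rV[R]_n := \row_i (i == Ordinal n0)%:R.
  have d1 : enorm d = 1.
    rewrite /enorm (_ : dotv d d = 1) ?sqrtr1// /dotv (bigD1 (Ordinal n0))//= big1.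
      by rewrite !mxE eqxx mulr1 addr0.
    by move=> i ne; rewrite !mxE (negbTE ne) mulr0.
  exists (cost ([set d], d)), ([set d], d) => //; split => //=.
    by move=> _ ->.
  by move=> _ _ -> ->; exact: dotvv_ge0.
pose B (e : R) := [set q : pair | admissible q /\ cost q < inf V + e].
have FF : Filter (filter_from [set e : R | 0 < e] B).
  apply: filter_from_filter; first by exists 1; exact: ltr01.
  move=> a b /= a0 b0; exists (Num.min a b); first by rewrite /= lt_min a0 b0.
  by move=> q [aq]; rewrite -ltrBlDl lt_min => /andP[??]; split; split => //; lra.
have PF : ProperFilter (filter_from [set e : R | 0 < e] B).
  apply: filter_from_proper => e /= e0.
  by have [_ [q aq <-] lt] := inf_adherent e0 infV; exists q.
have [G [UG FG]] := ultraFilterLemma PF.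
have Gadm : G (@admissible R n).
  by apply: FG; exists 1; [exact: ltr01|move=> q []].
have Gm e : 0 < e -> G [set q | cost q < inf V + e].
  by move=> e0; apply: FG; exists e => // q [].
have [u [au cu]] := limit_set_cost UG Gadm Gm.
exists (limit_set G, u); split => //; first exact: closed_limit_set.
move=> q' aq'; apply: le_trans cu _; apply: ge_inf; first by case: infV.
by exists q'.
Qed.

(** Given S in C and u in S*, the pair (S*, u) is admissible, its polar sector lies in S by
    [bipolar], and u pairs nonnegatively with S. So its cost bounds the moment of S from below. *)
Lemma Phi_minimizer : (2 <= n)%N -> exists (S0 : set 'rV[R]_n) (u0 : 'rV[R]_n),
  [/\ classC S0, dual_sector S0 u0,
    (forall (S : set 'rV[R]_n) (u : 'rV[R]_n),
      classC S -> dual_sector S u -> Phi S0 u0 <= Phi S u) &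
    0 < Phi S0 u0].
Proof.
move=> n2; have n0 : (0 < n)%N by exact: leq_trans n2.
have [[A u] [aq cA qmin]] := cost_minimizer n0.
have K0 : 0 < 2 / @omega R n * n%:R.
  by rewrite mulr_gt0 ?ltr0n// divr_gt0// omega_gt0.
have cP := @closed_polar_sector R n A.
exists (polar_sector A), u; split.
- by apply: polar_sector_classC; case: aq.
- case: aq => /= As _ Au; split; first exact: As.
  by move=> x [hx _]; rewrite dotvC hx.
- move=> S v CS Sv; have cS := classC_closed CS.
  rewrite !PhiE// ler_pM2l//.
  have adm : admissible (dual_sector S, v).
    by split => //=; [move=> ? []|exact: acute_dual_sector].
  apply: le_trans (qmin _ adm) _; apply: le_moment => //.
  + exact: closed_polar_sector.
  + by apply: bipolar; case: CS.
  + by move=> th Sth; rewrite dotvC; exact: Sv.2.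
- by rewrite PhiE// mulr_gt0//; exact: (@cost_gt0 (A, u)).
Qed.

End Minimizer.

(** * Lipschitz functions of one real variable *)

Section Lipschitz.
Variable R : realType.
Notation leb := (@lebesgue_measure R).

Lemma stieltjes_itv (F : cumulative R R) (s t : R) : s <= t ->
  lebesgue_stieltjes_measure F `]s, t]%classic = (F t - F s)%:E.
Proof.
move=> st; rewrite /lebesgue_stieltjes_measure /measure_extension/=.
rewrite measurable_mu_extE/=; last exact: is_ocitv.
by rewrite wlength_itv_bnd.
Qed.

(** Composition with it extends a function on [a, b] by constants to the whole line, where Stieltjes
    measures are defined. *)
Definition clamp (a b t : R) := Num.max a (Num.min b t).

Lemma clamp_id (a b t : R) : a <= t <= b -> clamp a b t = t.
Proof. by move=> /andP[? ?]; rewrite /clamp min_r// max_r. Qed.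

Lemma clamp_bnd (a b t : R) : a <= b -> a <= clamp a b t <= b.
Proof. by move=> ab; rewrite /clamp le_max lexx/= ge_max ab ge_min lexx. Qed.

Lemma le_clamp (a b s t : R) : s <= t -> clamp a b s <= clamp a b t.
Proof.
move=> st; rewrite /clamp ge_max !le_max lexx/=.
by rewrite le_min !ge_min lexx/= st orbT orbT.
Qed.

Lemma clamp_lip (a b s t : R) : s <= t -> clamp a b t - clamp a b s <= t - s.
Proof. by rewrite /clamp /Num.max /Num.min; do !case: ifPn; rewrite -?leNgt; lra. Qed.

Lemma lip1_continuous (F : R -> R) :
  (forall s t, s <= t -> 0 <= F t - F s <= t - s) -> continuous F.
Proof.
move=> hF x; apply/cvgrPdist_lt => e e0; near=> y.
apply: (@le_lt_trans _ _ `|x - y|); last by near: y; exact: cvgr_dist_lt.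
have [xy|/ltW yx] := leP x y.
  by have /andP[? ?] := hF _ _ xy; rewrite distrC (distrC x) !ger0_norm ?subr_ge0//; lra.
by have /andP[? ?] := hF _ _ yx; rewrite !ger0_norm ?subr_ge0//; lra.
Unshelve. all: by end_near. Qed.

Lemma derivable_near_shift (P f : R -> R) (c x d : R) :
  derivable P x 1 -> derive1 P x = d -> {near x, (fun y => P y + c) =1 f} ->
  derivable f x 1 /\ derive1 f x = d.
Proof.
move=> dP Pd Pf.
have isP : is_derive x 1 P d by apply: DeriveDef => //; rewrite -derive1E.
have isc : is_derive x 1 (cst c : R -> R) 0 by exact: is_derive_cst.
have isPc : is_derive x 1 (P + cst c) d.
  by rewrite -[d]addr0; exact: (is_deriveD isP isc).
have isf : is_derive x 1 f d by exact: (near_eq_is_derive Pf isPc).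
by split; [exact: ex_derive|rewrite derive1E; exact: derive_val].
Qed.

Section Monotone.
Variables (f : R -> R) (a b : R).
Hypothesis ab : a < b.
Hypothesis flip : forall s t, a <= s -> s <= t -> t <= b -> 0 <= f t - f s <= t - s.

Let F t := f (clamp a b t).
Let H t := clamp a b t - F t.

Let F_lip s t : s <= t -> 0 <= F t - F s <= clamp a b t - clamp a b s.
Proof.
move=> st; have /andP[as_ _] := clamp_bnd s (ltW ab).
have /andP[_ tb] := clamp_bnd t (ltW ab).
exact: flip as_ (le_clamp _ _ st) tb.
Qed.

Let F_lip1 s t : s <= t -> 0 <= F t - F s <= t - s.
Proof.
move=> st; have := F_lip st; have := clamp_lip a b st => h /andP[-> h2] /=.
exact: le_trans h2 h.
Qed.

Let H_lip1 s t : s <= t -> 0 <= H t - H s <= t - s.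
Proof.
move=> st; have /andP[] := F_lip st; have := clamp_lip a b st; rewrite /H.
move: (F t) (F s) (clamp a b t) (clamp a b s) => ? ? ? ? ? ? ?.
by apply/andP; split; lra.
Qed.

Let clamp_lip1 s t : s <= t -> 0 <= clamp a b t - clamp a b s <= t - s.
Proof. by move=> st; rewrite (clamp_lip a b st) subr_ge0 (le_clamp a b st). Qed.

Let mk (K : R -> R) : (forall s t, s <= t -> 0 <= K t - K s <= t - s) ->
  exists Kc : cumulative R R, (Kc : R -> R) = K.
Proof.
move=> hK.
have nd : nondecreasing K by move=> s t /hK/andP[+ _]; rewrite subr_ge0.
have rc : right_continuous K by apply: right_continuousW; exact: lip1_continuous.
pose Kc : cumulative R R := HB.pack K (isCumulative.Build R _ R K nd rc).
by exists Kc.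
Qed.

(* The Stieltjes measures of [f] and [id - f] add up to Lebesgue measure on
   ]a, b], so that of [f] has a Radon-Nikodym density. *)
Lemma lip1_density : exists phi : R -> R,
  [/\ leb.-integrable setT (EFin \o phi),
      forall s t, a <= s -> s <= t -> t <= b ->
        f t - f s = \int[leb]_(u in `]s, t]%classic) phi u &
      {ae leb, forall x, a < x < b -> derivable f x 1 /\ derive1 f x = phi x}].
Proof.
have [Fc FcE] := mk F_lip1; have [Hc HcE] := mk H_lip1.
have [Ic IcE] := mk clamp_lip1.
pose muF := lebesgue_stieltjes_measure Fc.
pose muH := lebesgue_stieltjes_measure Hc.
have mab : measurable (`]a, b]%classic : set (measurableTypeR R)) by exact: measurable_itv.
have add A : measurable A -> (muF A + muH A = leb (A `&` `]a, b]))%E.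
  move=> mA; rewrite -[LHS]measure_addE.
  (* Both sides agree on half-open intervals with the Stieltjes measure of [clamp a b], so
     uniqueness is applied twice. *)
  transitivity (lebesgue_stieltjes_measure Ic A).
    apply/esym; apply: (@lebesgue_stieltjes_measure_unique R Ic (measure_add muF muH)) => //.
    move=> _ [[s t] _ <-] /=; have [st|ts] := leP s t; last first.
      by rewrite set_itv_ge ?measure0// bnd_simp -leNgt ltW.
    rewrite stieltjes_itv//.
    transitivity ((Fc t - Fc s)%:E + (Hc t - Hc s)%:E)%E; last first.
      rewrite -(stieltjes_itv Fc st) -(stieltjes_itv Hc st).
      exact/esym/measure_addE.
    by rewrite -EFinD FcE HcE IcE /H; congr (_%:E); ring.
  apply: (@lebesgue_stieltjes_measure_unique R Ic (mrestr leb mab)) => //.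
  move=> _ [[s t] _ <-] /=; have [st|ts] := leP s t; last first.
      by rewrite set_itv_ge ?measure0// bnd_simp -leNgt ltW.
    rewrite stieltjes_itv// /mrestr.
    have -> : `]s, t]%classic `&` `]a, b]%classic = `](clamp a b s), (clamp a b t)]%classic.
      apply/seteqP; split => u /=; rewrite !in_itv/= /clamp.
        move=> [/andP[su ut] /andP[au ub]].
        by rewrite gt_max au gt_min su orbT/= le_max le_min ub ut orbT.
      rewrite gt_max gt_min le_max le_min => /andP[/andP[au su] tu].
      have [ub ut] : u <= b /\ u <= t.
        by case/orP : tu => [|/andP[]//]; rewrite leNgt au.
      rewrite au ub ut; split => //; rewrite andbT.
      by case/orP : su => //; rewrite ltNge ub.
    rewrite lebesgue_measure_itv/= lte_fin IcE.
    by case: ltP => // h; congr (_%:E); have := le_clamp a b st; lra.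
have leF A : measurable A -> (muF A <= leb (A `&` `]a, b]))%E.
  by move=> mA; rewrite -add// leeDl// measure_ge0.
have finF : fin_num_fun muF.
  move=> A mA; rewrite ge0_fin_numE ?measure_ge0//.
  apply: le_lt_trans (leF A mA) _.
  apply: (@le_lt_trans _ _ (leb `]a, b])).
    by apply: le_measure; rewrite ?inE//; exact: measurableI.
  by rewrite lebesgue_measure_itv/=; case: ifP => _; rewrite ?ltry// -EFinB ltry.
pose nu : {finite_measure set (measurableTypeR R) -> \bar R} :=
  HB.pack muF (Measure_isFinite.Build _ _ _ muF finF).
have dom : nu `<< leb.
  apply/null_content_dominatesP => A mA A0; apply/eqP.
  rewrite eq_le measure_ge0 andbT (le_trans (leF A mA))// -A0.
  by apply: le_measure; rewrite ?inE//; exact: measurableI.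
have [g [g0 gfin ig gE]] := radon_nikodym_sigma_finite dom.
pose phi := fine \o g.
have phiE : EFin \o phi = g by apply/funext => x /=; rewrite fineK.
have iphi : leb.-integrable setT (EFin \o phi) by rewrite phiE.
have iphiA A : measurable A -> leb.-integrable A (EFin \o phi).
  by move=> mA; apply: integrableS iphi.
have FE s t : s <= t -> F t - F s = \int[leb]_(u in `]s, t]%classic) phi u.
  move=> st; have := gE _ (measurable_itv `]s, t]).
  have -> : nu `]s, t]%classic = (F t - F s)%:E.
    by rewrite -FcE; exact: stieltjes_itv.
  rewrite /Rintegral => e; rewrite -[LHS]/(fine (F t - F s)%:E) e.
  by congr fine; apply: eq_integral => u _; rewrite /= fineK.
exists phi; split => //.
  move=> s t as_ st tb; rewrite -FE// /F !clamp_id//; first by rewrite as_ (le_trans st).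
  by rewrite tb (le_trans as_).
have loc : locally_integrable [set: R] phi.
  by apply: open_integrable_locally => //; exact: openT.
have := @FTC1Ny R phi (fun y => iphiA _ (measurable_itv _)) loc.
apply: filterS; first exact: (ae_filter_ringOfSetsType leb).
move=> x /= [dx ex] /andP[ax xb].
(* The fundamental theorem differentiates this primitive; near a point of ]a, b[ it differs from f
   by a constant. *)
pose P y := \int[leb]_(t in `]-oo, y]%classic) phi t.
have PE : {near x, (fun y => P y + (F a - P a)) =1 f}.
  near=> y.
  have ay : a <= y by near: y; exact: lt_le_nbhsr.
  have yb : y <= b by near: y; exact: lt_le_nbhsl.
  have -> : f y = F y by rewrite /F clamp_id// ay.
  have := FE _ _ ay.
  rewrite -(@Rintegral_itvB R phi -oo%O (BRight y) a)//; last exact: iphiA.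
  by rewrite -/(P y) -/(P a) => /eqP; rewrite subr_eq addrAC -addrA => /eqP ->.
exact: derivable_near_shift dx ex PE.
Unshelve. all: by end_near. Qed.

End Monotone.
End Lipschitz.

Section LipschitzDensity.
Variable R : realType.
Notation leb := (@lebesgue_measure R).

Lemma Rintegral_itv_cat (phi : R -> R) (s t u : R) :
  leb.-integrable setT (EFin \o phi) -> s <= t -> t <= u ->
  \int[leb]_(v in `]s, u]%classic) phi v =
  \int[leb]_(v in `]s, t]%classic) phi v + \int[leb]_(v in `]t, u]%classic) phi v.
Proof.
move=> iphi st tu.
rewrite -(@Rintegral_itvB R phi (BRight s) (BRight u) t) ?bnd_simp//.
  by rewrite addrC subrK.
by apply: integrableS iphi => //; exact: measurable_itv.
Qed.

Lemma integrable_indic_oc (a b : R) :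
  leb.-integrable setT (EFin \o (\1_(`]a, b]%classic) : R -> R)).
Proof.
apply/integrableP; split.
  by apply/measurable_EFinP/measurable_indic; exact: measurable_itv.
rewrite (_ : (\int[leb]_x _)%E = (\int[leb]_x (\1_(`]a, b]%classic) x)%:E)%E); last first.
  by apply: eq_integral => x _; rewrite /= ger0_norm ?indicE.
rewrite integral_indic//.
by rewrite setIT/= lebesgue_measure_itv/=; case: ifP => _; rewrite -?EFinB ltry.
Qed.

(** With c = C + 1, positive even when C = 0, the function g = (f/c + id)/2 is nondecreasing and
    1-Lipschitz, so [lip1_density] applies to it; then f = c (2g - id). *)
Lemma lip_density (f : R -> R) (a b C : R) : a < b -> 0 <= C ->
  (forall s t, a <= s -> s <= t -> t <= b -> `|f t - f s| <= C * (t - s)) ->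
  exists phi : R -> R,
  [/\ leb.-integrable setT (EFin \o phi),
      forall s t, a <= s -> s <= t -> t <= b ->
        f t - f s = \int[leb]_(u in `]s, t]%classic) phi u &
      {ae leb, forall x, a < x < b -> derivable f x 1 /\ derive1 f x = phi x}].
Proof.
move=> ab C0 flip; pose c := C + 1; have c0 : 0 < c by rewrite ltr_wpDl.
pose g u := (f u / c + u) / 2.
have glip s t : a <= s -> s <= t -> t <= b -> 0 <= g t - g s <= t - s.
  move=> as_ st tb; have := flip _ _ as_ st tb.
  have : C * (t - s) <= c * (t - s) by rewrite ler_wpM2r ?subr_ge0// lerDl.
  have -> : g t - g s = ((f t - f s) / c + (t - s)) / 2 by rewrite /g; ring.
  move=> h1 /le_trans/(_ h1); rewrite ler_norml => /andP[h2 h3].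
  have : (f t - f s) / c <= t - s by rewrite ler_pdivrMr// mulrC.
  have : - (t - s) <= (f t - f s) / c by rewrite ler_pdivlMr// mulNr mulrC.
  by move=> h4 h5; apply/andP; split; lra.
have [phi [iphi phiE phid]] := lip1_density ab glip.
have fE u : f u = c * (2 * g u - u) by rewrite /g; field; rewrite gt_eqF.
(* The density of id on ]a, b], cut off so as to be integrable on the whole line. *)
pose one : R -> R := \1_(`]a, b]%classic).
have ione := integrable_indic_oc a b.
exists (fun u => c * (2 * phi u - one u)).
have i2 : leb.-integrable setT (EFin \o (fun u => 2 * phi u)).
  rewrite (_ : _ \o _ = (fun u => 2%:E * (phi u)%:E)%E)//; exact: integrableZl.
have i3 : leb.-integrable setT (EFin \o (fun u => 2 * phi u - one u)).
  rewrite (_ : _ \o _ = (fun u => (2 * phi u)%:E - (one u)%:E)%E)//; exact: integrableB.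
split.
- rewrite (_ : _ \o _ = (fun u => c%:E * (2 * phi u - one u)%:E)%E)//; exact: integrableZl.
- move=> s t as_ st tb; have mst := @measurable_itv R `]s, t].
  have sub h : leb.-integrable setT h -> leb.-integrable `]s, t]%classic h.
    by apply: integrableS.
  rewrite RintegralZl//; last exact: sub i3.
  rewrite RintegralB//; [|exact: sub i2|exact: sub ione].
  rewrite RintegralZl//; last exact: sub iphi.
  rewrite -(phiE _ _ as_ st tb).
  rewrite (@eq_Rintegral _ _ _ leb _ (fun=> 1)); last first.
    move=> u /set_mem/=; rewrite in_itv/= => /andP[su ut].
    rewrite /one indicE mem_set//= in_itv/= (le_lt_trans as_ su)/=.
    exact: le_trans ut tb.
  rewrite Rintegral_cst// mul1r/= lebesgue_measure_itv/= lte_fin.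
  rewrite [in LHS](fE t) [in LHS](fE s); case: ltP => ts; rewrite -?EFinB/=; first by ring.
  have -> : s = t by apply/eqP; rewrite eq_le st.
  by ring.
move: phid; apply: filterS; first exact: (ae_filter_ringOfSetsType leb).
move=> x + xab => /(_ xab) [dg eg].
have isg : is_derive x 1 g (phi x) by apply: DeriveDef => //; rewrite -derive1E.
have isid : is_derive x 1 (id : R -> R) 1 by exact: is_derive_id.
have isf : is_derive x 1 f (c * (2 * phi x - one x)).
  have -> : one x = 1.
    by case/andP : xab => ax xb; rewrite /one indicE mem_set//= in_itv/= ax ltW.
  have -> : f = c \*: (2 \*: g - id) by apply/funext => u; rewrite fE.
  exact: (is_deriveZ c (is_deriveB (is_deriveZ 2 isg) isid)).
by split; [exact: ex_derive|rewrite derive1E; exact: derive_val].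
Qed.

Lemma ae_derive_ge0_le (f : R -> R) (a b C : R) : a <= b -> 0 <= C ->
  (forall s t, a <= s -> s <= t -> t <= b -> `|f t - f s| <= C * (t - s)) ->
  {ae leb, forall x, a < x < b -> derivable f x 1 /\ 0 <= derive1 f x} ->
  f a <= f b.
Proof.
rewrite le_eqVlt => /predU1P[->//|ab] C0 flip aef.
have [phi [iphi phiE phid]] := lip_density ab C0 flip.
rewrite -subr_ge0 phiE ?(ltW ab)//.
have mI := @measurable_itv R `]a, b].
have mphi : measurable_fun setT phi by apply/measurable_EFinP; exact: measurable_int iphi.
rewrite /Rintegral (@ae_eq_integral _ _ _ leb _ (fun u => (Num.max (phi u) 0)%:E))//.
- by apply: fine_ge0; apply: integral_ge0 => u _; rewrite lee_fin le_max lexx orbT.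
- by apply/measurable_EFinP; exact: measurable_funTS.
- by apply/measurable_EFinP/measurable_funTS/measurable_maxr.
(* The integral runs over ]a, b], while the sign of the derivative is known on ]a, b[ only. *)
have nb : {ae leb, forall x, x != b}.
  by exists [set b]; split => //; [exact: lebesgue_measure_set1|move=> u /=; case: eqP].
have aeF := ae_filter_ringOfSetsType leb.
apply: (@filterS _ _ aeF _ _ _
  (@filterI _ _ aeF _ _ aef (@filterI _ _ aeF _ _ phid nb))).
move=> u [hf [hp ub]] /=; rewrite in_itv/= => /andP[au ubb].
have uab : a < u < b by rewrite au lt_neqAle ub.
by have [_ <-] := hp uab; have [_ h] := hf uab; rewrite max_l.
Qed.

Section VectorDerivative.
Variables (n : nat) (x : R -> 'rV[R]_n) (s : R).
Hypothesis dx : derivable x s 1.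

Lemma is_derive_dotv (th : 'rV[R]_n) :
  is_derive s 1 (fun t => dotv th (x t)) (dotv th (derive1 x s)).
Proof.
have cv : (fun h => dotv th (h^-1 *: (x (h *: 1 + s) - x s))) @ 0^' -->
    dotv th ('D_1 x s).
  apply: (@cvg_comp _ _ _ _ (dotv th) _ (nbhs ('D_1 x s))) => //.
  exact: continuous_dotv.
rewrite derive1E; apply: DeriveDef.
  apply/cvg_ex; exists (dotv th ('D_1 x s)).
  apply: cvg_trans cv; apply: near_eq_cvg; apply: nearW => h /=.
  by rewrite dotvZr dotvBr.
apply/cvg_lim => //; apply: cvg_trans cv; apply: near_eq_cvg; apply: nearW => h /=.
by rewrite dotvZr dotvBr.
Qed.

End VectorDerivative.

End LipschitzDensity.

Lemma Rintegral_bigsum d (T : measurableType d) (R : realType)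
    (mu : {measure set T -> \bar R}) (D : set T) I (r : seq I) (F : I -> T -> R) :
  measurable D -> (forall i, mu.-integrable D (EFin \o F i)) ->
  mu.-integrable D (EFin \o (fun u => \sum_(i <- r) F i u)) /\
  \int[mu]_(u in D) (\sum_(i <- r) F i u) = \sum_(i <- r) \int[mu]_(u in D) F i u.
Proof.
move=> mD iF; elim: r => [|i r [iS eS]].
  rewrite (_ : (fun u => _) = cst 0); last by apply/funext => u; rewrite big_nil.
  split; first exact: integrable0.
  by rewrite big_nil /Rintegral integral0.
rewrite (_ : (fun u => _) = (fun u => F i u + \sum_(j <- r) F j u)); last first.
  by apply/funext => u; rewrite big_cons.
split; last by rewrite RintegralD// eS big_cons.
exact: (integrableD mD (iF i) iS).
Qed.

(** * Arc-length parametrised steepest descent curves *)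

Section Curve.
Variables (R : realType) (n : nat) (x : R -> 'rV[R]_n) (L : R).
Notation leb := (@lebesgue_measure R).
Hypothesis arc : arclength_param x L.

(** The single chord is one of the inscribed polygons whose supremum is the length. *)
Lemma arclength_lip s t : 0 <= s -> s <= t -> t <= L -> enorm (x t - x s) <= t - s.
Proof.
move=> s0 st tL; rewrite -lee_fin -(arc s0 st tL); apply: ereal_sup_ubound.
by exists [:: t]; rewrite /= ?st ?addr0.
Qed.

Lemma path_le_last (s : R) (l : seq R) : path <=%R s l -> s <= last s l.
Proof.
elim: l s => [s _|t l IH s] /=; first exact: lexx.
by move=> /andP[st /IH]; exact: le_trans.
Qed.

Let e_ i : 'rV[R]_n := \row_j (j == i)%:R.

Let dotv_e i v : dotv (e_ i) v = v ord0 i.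
Proof.
rewrite /dotv (bigD1 i)//= mxE eqxx mul1r big1 ?addr0// => j ji.
by rewrite mxE (negbTE ji) mul0r.
Qed.

Lemma is_derive_coord s i : derivable x s 1 ->
  is_derive s 1 (fun t => x t ord0 i) (derive1 x s ord0 i).
Proof.
move=> dx; rewrite -(dotv_e i (derive1 x s)).
rewrite (_ : (fun t => _) = fun t => dotv (e_ i) (x t)).
  exact: is_derive_dotv.
by apply/funext => t; rewrite dotv_e.
Qed.

Lemma enorm_derive_le1 s : 0 < s < L -> derivable x s 1 -> enorm (derive1 x s) <= 1.
Proof.
move=> /andP[s0 sL] dx.
have cv : enorm (h^-1 *: (x (h *: 1 + s) - x s)) @[h --> 0^'] --> enorm ('D_1 x s).
  apply: (@cvg_comp _ _ _ _ (@enorm R n) _ (nbhs ('D_1 x s))) => //.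
  exact: continuous_enorm.
rewrite derive1E; apply: (cvgr_to_le cv); near=> h.
have h0 : h != 0 by near: h; exact: nbhs_dnbhs_neq.
have hs : `|h| < Num.min s (L - s).
  by near: h; apply: dnbhs0_lt; rewrite lt_min s0 subr_gt0.
move: hs; rewrite lt_min => /andP[h1 h2].
have [h3 h4] : - s < h < s /\ - (L - s) < h < L - s by rewrite -!ltr_norml.
rewrite /GRing.scale/= mulr1 enormZ normfV ler_pdivrMl ?normr_gt0// mulr1.
have [hp|/ltW hn] := leP 0 h.
  rewrite ger0_norm//; apply: le_trans (arclength_lip _ _ _) _; lra.
rewrite ler0_norm// enormB; apply: le_trans (arclength_lip _ _ _) _; lra.
Unshelve. all: by end_near. Qed.

(* A chord is at most the integral of |x'| over its interval, so L <= int |x'|,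
   while |x'| <= 1. *)
Lemma unit_speed :
  {ae leb, forall s, 0 < s < L -> derivable x s 1} ->
  {ae leb, forall s, 0 < s < L -> enorm (derive1 x s) = 1}.
Proof.
move=> dx; have [L0|L0] := leP L 0.
  apply: aeW => s /andP[s0 sL].
  by exfalso; have := lt_le_trans (lt_trans s0 sL) L0; rewrite ltxx.
have aeF := ae_filter_ringOfSetsType leb.
have dens i : exists phi : R -> R, [/\ leb.-integrable setT (EFin \o phi),
    forall s t, 0 <= s -> s <= t -> t <= L ->
      x t ord0 i - x s ord0 i = \int[leb]_(u in `]s, t]%classic) phi u &
    {ae leb, forall s, 0 < s < L -> derivable (fun t => x t ord0 i) s 1 /\
      derive1 (fun t => x t ord0 i) s = phi s}].
  apply: (lip_density L0 ler01) => s t s0 st tL; rewrite mul1r.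
  apply: le_trans (arclength_lip s0 st tL).
  by have := ler_coord_enorm (x t - x s) i; rewrite !mxE.
have [phi hphi] := choice dens.
have iphi i : leb.-integrable setT (EFin \o phi i) by case: (hphi i).
(* An integrable stand-in for |x'|, built from the densities of the coordinates. *)
pose psi u := enorm (\row_i phi i u).
have mpsi : measurable_fun setT psi.
  apply: (mfunRn_comp (T := fun u : measurableTypeR R => \row_i phi i u)
    (continuous_mfunRn (@continuous_enorm R n))) => i.
  rewrite (_ : (fun p => _) = phi i); last by apply/funext => u; rewrite mxE.
  by apply/measurable_EFinP; exact: measurable_int (iphi i).
have ipsi : leb.-integrable setT (EFin \o psi).
  have iabs i : leb.-integrable setT (EFin \o (fun u => `|phi i u|)).
    exact: (integrable_abse (iphi i)).
  have [iS _] := Rintegral_bigsum (index_enum 'I_n) measurableT iabs.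
  apply: (@le_integrable _ _ _ leb setT measurableT _ _ _ _ iS) => //.
    exact/measurable_EFinP.
  move=> u _ /=; rewrite lee_fin ger0_norm ?enorm_ge0//.
  rewrite ger0_norm ?sumr_ge0//; apply: le_trans (enorm_le_sum _) _.
  by apply: ler_sum => i _; rewrite mxE.
have mitv s t : measurable (`]s, t]%classic : set (measurableTypeR R)).
  exact: measurable_itv.
have iI f s t : leb.-integrable setT f -> leb.-integrable `]s, t]%classic f.
  by apply: integrableS => //; exact: mitv.
pose I s t := \int[leb]_(u in `]s, t]%classic) psi u.
have chord s t : 0 <= s -> s <= t -> t <= L -> enorm (x t - x s) <= I s t.
  move=> s0 st tL; set d := x t - x s.
  have I0 : 0 <= I s t by apply: Rintegral_ge0 => u _; exact: enorm_ge0.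
  have [->|d0] := eqVneq d 0; first by rewrite enorm0.
  (* After multiplication by |d|, the left side |d|^2 is the integral of the pairing of d with the
     density vector, and Cauchy-Schwarz applies under the integral. *)
  rewrite -enorm_gt0 in d0; rewrite -(ler_pM2l d0) -expr2 sqr_enorm.
  have iZ i : leb.-integrable `]s, t]%classic (EFin \o (fun u => d ord0 i * phi i u)).
    apply: (iI _ s t); exact: (integrableZl measurableT (d ord0 i) (iphi i)).
  have [iS eS] := Rintegral_bigsum (index_enum 'I_n) (mitv s t) iZ.
  have -> : dotv d d = \int[leb]_(u in `]s, t]%classic)
      (\sum_(i <- index_enum 'I_n) d ord0 i * phi i u).
    rewrite eS; apply: eq_bigr => i _.
    rewrite RintegralZl//; last exact: iI (iphi i).
    by congr (_ * _); case: (hphi i) => _ <- //; rewrite !mxE.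
  rewrite -RintegralZl//; last exact: iI ipsi.
  apply: le_Rintegral => //.
    by apply: (iI _ s t); exact: (integrableZl measurableT (enorm d) ipsi).
  move=> u _; apply: le_trans (cauchy_schwarz d (\row_i phi i u)).
  by rewrite /dotv; apply: ler_sum => i _; rewrite mxE.
have poly l s : 0 <= s -> path <=%R s l -> last s l <= L ->
    poly_len x s l <= I s (last s l).
  elim: l s => [s _ _ _|t l IH s s0] /=.
    by apply: Rintegral_ge0 => u _; exact: enorm_ge0.
  move=> /andP[st pl] lL; have tl := path_le_last pl.
  rewrite /I (Rintegral_itv_cat ipsi st tl); apply: lerD.
    by apply: chord => //; exact: le_trans tl lL.
  by apply: IH => //; exact: le_trans s0 st.
have LI : L <= I 0 L.
  have := arc (lexx 0) (ltW L0) (lexx L); rewrite subr0 -lee_fin => <-.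
  apply: ge_ereal_sup => _ [l [pl lL] <-]; rewrite lee_fin -{1}lL.
  by apply: poly => //; rewrite lL.
have psiE : {ae leb, forall s, 0 < s < L -> psi s = enorm (derive1 x s) /\ psi s <= 1}.
  (* Indexing by natural numbers makes this a countable intersection of almost-sure statements,
     vacuous for k at least n. *)
  have all_i : {ae leb, forall s (k : nat) (i : 'I_n), nat_of_ord i = k ->
      0 < s < L -> derive1 (fun t => x t ord0 i) s = phi i s}.
    apply: ae_foralln => k; have [kn|nk] := ltnP k n; last first.
      by apply: aeW => s i ik; move: (ltn_ord i); rewrite ik ltnNge nk.
    have [_ _ h] := hphi (Ordinal kn).
    apply: (@filterS _ _ aeF _ _ _ h) => s hs i ik sL.
    have -> : i = Ordinal kn by exact: val_inj.
    exact: (hs sL).2.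
  apply: (@filterS _ _ aeF _ _ _ (@filterI _ _ aeF _ _ dx all_i)).
  move=> s [ds hs] sL; have {}ds := ds sL.
  have e : psi s = enorm (derive1 x s).
    congr enorm; apply/rowP => i; rewrite mxE -(hs i i)// derive1E.
    by have ? := is_derive_coord i ds; rewrite derive_val.
  by split => //; rewrite e enorm_derive_le1.
have nL : {ae leb, forall s, s != L}.
  by exists [set L]; split => //; [exact: lebesgue_measure_set1|move=> u /=; case: eqP].
have mD := mitv 0 L.
pose one : R -> R := \1_(`]0, L]%classic).
have oneE u : `]0, L]%classic u -> one u = 1 by move=> h; rewrite /one indicE mem_set.
have ione := integrable_indic_oc 0 L.
have mf : measurable_fun `]0, L]%classic (fun u => (one u - psi u)%:E).
  apply/measurable_EFinP/measurable_funTS; apply: measurable_funB => //.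
  exact: measurable_indic.
have z : (\int[leb]_(u in `]0%R, L]) `|(one u - psi u)%:E| = 0)%E.
  apply/eqP; rewrite eq_le; apply/andP; split; last exact: integral_ge0.
  rewrite (@ae_eq_integral _ _ _ leb _ (fun u => (one u - psi u)%:E))//; last 2 first.
  - exact: measurableT_comp.
  - apply: (@filterS _ _ aeF _ _ _ (@filterI _ _ aeF _ _ psiE nL)).
    move=> u [hu uL] /= uD; rewrite oneE//; move: uD; rewrite in_itv/= => /andP[u0 uL'].
    have [|_ h] := hu; first by rewrite u0 lt_neqAle uL.
    by rewrite ger0_norm// subr_ge0.
  rewrite -[leLHS]fineK; last first.
    by apply: integrable_fin_num => //; exact: integrableB (iI _ _ _ ione) (iI _ _ _ ipsi).
  rewrite lee_fin -[leLHS]/(\int[leb]_(u in `]0, L]%classic) (one u - psi u))%R.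
  rewrite RintegralB//; [|exact: iI ione|exact: iI ipsi].
  rewrite subr_le0; apply: le_trans LI.
  rewrite (@eq_Rintegral _ _ _ leb _ (fun=> 1)); last by move=> u /set_mem/oneE.
  by rewrite Rintegral_cst// mul1r/= lebesgue_measure_itv/= lte_fin L0 -EFinB subr0.
have /(ae_eq_integral_abs _ mD mf) := z.
move=> az; apply: (@filterS _ _ aeF _ _ _ (@filterI _ _ aeF _ _ psiE az)).
move=> s [ps as_] sL; have [<- _] := ps sL.
have sD : `]0, L]%classic s by case/andP: sL => s0 ?; rewrite /= in_itv/= s0 ltW.
by have /= [/eqP] := as_ sD; rewrite oneE// subr_eq0 => /eqP.
Qed.

End Curve.

(** * Monotone distances and acute chords to the past *)

Section Past.
Variables (R : realType) (n : nat) (x : R -> 'rV[R]_n) (L : R).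
Notation leb := (@lebesgue_measure R).
Hypothesis arc : arclength_param x L.
Hypothesis steep : {ae leb, forall s, 0 < s < L -> derivable x s 1 /\
  forall sig, 0 <= sig <= s -> 0 <= dotv (derive1 x s) (x s - x sig)}.

Lemma is_derive_sqdist (c : 'rV[R]_n) s : derivable x s 1 ->
  is_derive s 1 (fun t => dotv (x t - c) (x t - c))
    (2 * dotv (derive1 x s) (x s - c)).
Proof.
move=> dx; pose g i (t : R) : R := x t ord0 i - c ord0 i.
have dg (i : 'I_n) : is_derive s 1 (g i) (derive1 x s ord0 i).
  have dxi := is_derive_coord i dx.
  have dc : is_derive s 1 (cst (c ord0 i) : R -> R) 0 by exact: is_derive_cst.
  by rewrite -[derive1 x s ord0 i]subr0; exact: (is_deriveB dxi dc).
have dgg (i : 'I_n) : is_derive s 1 (g i * g i)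
    (g i s *: derive1 x s ord0 i + g i s *: derive1 x s ord0 i).
  exact: (is_deriveM (dg i) (dg i)).
have := is_derive_sum dgg.
rewrite (_ : \sum_(i < n) (g i * g i) = fun t => dotv (x t - c) (x t - c)).
  move=> h; rewrite (_ : 2 * _ = \sum_(i < n)
    (g i s *: derive1 x s ord0 i + g i s *: derive1 x s ord0 i))//.
  rewrite /dotv mulr_sumr; apply: eq_bigr => i _.
  by rewrite !mxE /g /GRing.scale/=; ring.
apply/funext => t; rewrite /dotv.
rewrite (big_morph (fun f : R -> R => f t) (id1 := 0) (op1 := +%R))//.
by apply: eq_bigr => i _; rewrite !mxE.
Qed.

(** The squared distance to [x sig] has almost everywhere the derivative that the descent condition
    makes nonnegative. It is Lipschitz with constant L + L: a difference of squares is the pairing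
    of a chord with a sum of two chords of length at most L. *)
Lemma le_dist_past sig t s : 0 <= sig -> sig <= t -> t <= s -> s <= L ->
  enorm (x t - x sig) <= enorm (x s - x sig).
Proof.
move=> sig0 sigt ts sL.
rewrite -(ler_pXn2r (ltn0Sn 1)) ?nnegrE ?enorm_ge0// !sqr_enorm.
have t0 := le_trans sig0 sigt.
have L0 : 0 <= L by exact: le_trans (le_trans t0 ts) sL.
apply: (@ae_derive_ge0_le R (fun u => dotv (x u - x sig) (x u - x sig)) t s (L + L)) => //.
- by rewrite addr_ge0.
- move=> u v tu uv vs.
  have u0 := le_trans t0 tu; have vL := le_trans vs sL.
  have -> : dotv (x v - x sig) (x v - x sig) - dotv (x u - x sig) (x u - x sig) =
      dotv (x v - x u) ((x v - x sig) + (x u - x sig)).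
    have -> : x v - x u = (x v - x sig) - (x u - x sig).
      by apply/rowP => i; rewrite !mxE; ring.
    move: (x v - x sig) (x u - x sig) => p q.
    by rewrite dotvBl !dotvDr (dotvC q p); ring.
  apply: le_trans (abs_cauchy_schwarz _ _) _; rewrite mulrC.
  apply: ler_pM; rewrite ?enorm_ge0//; last exact: (arclength_lip arc u0 uv vL).
  apply: le_trans (enormD _ _) _; apply: lerD.
    apply: le_trans (arclength_lip arc sig0 _ vL) _; lra.
  apply: le_trans (arclength_lip arc sig0 _ _) _; lra.
have aeF := ae_filter_ringOfSetsType leb.
apply: (@filterS _ _ aeF _ _ _ steep) => u hu /andP[tu us].
have [|du hs] := hu; first by rewrite (le_lt_trans t0)//= (lt_le_trans us).
have d := is_derive_sqdist (x sig) du.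
split; first exact: ex_derive.
by rewrite derive1E derive_val mulr_ge0// hs// sig0 (le_trans sigt)// ltW.
Qed.

(** For a <= b let p and q be the chords from [x a] and [x b] to [x s]. Monotonicity of the distance
    to [x a] says |p - q| <= |p|, that is, 2<p, q> >= |q|^2. *)
Lemma acute_past s : 0 <= s <= L -> acute [set x s - x sig | sig in `[0, s]%classic].
Proof.
move=> /andP[s0 sL] ? ? [a + <-] [b + <-].
rewrite /= !in_itv/= => /andP[a0 as_] /andP[b0 bs].
wlog ab : a b a0 as_ b0 bs / a <= b.
  move=> wl; have [|/ltW] := leP a b; first exact: wl.
  by rewrite dotvC; exact: wl.
have := le_dist_past a0 ab bs sL.
rewrite -(ler_pXn2r (ltn0Sn 1)) ?nnegrE ?enorm_ge0// !sqr_enorm.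
have -> : x b - x a = (x s - x a) - (x s - x b).
  by apply/rowP => i; rewrite !mxE; ring.
move: (x s - x a) (x s - x b) => p q.
rewrite dotvBl !dotvBr (dotvC q p); have := dotvv_ge0 q; lra.
Qed.

End Past.

(** * Support functions and mean width *)

Section SupportFunction.
Variables (R : realType) (n : nat).
Implicit Types (E : set 'rV[R]_n) (th y : 'rV[R]_n).

Lemma conv_hull_le E th (c : R) : (forall y, E y -> dotv th y <= c) ->
  forall y, conv_hull E y -> dotv th y <= c.
Proof.
move=> Ec y hy; apply: (hy [set z | dotv th z <= c]) => // u v t /= uc vc /andP[t0 t1].
rewrite dotvDr !dotvZr.
have h1 : t * dotv th u <= t * c by rewrite ler_wpM2l.
have h2 : (1 - t) * dotv th v <= (1 - t) * c by rewrite ler_wpM2l// subr_ge0.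
lra.
Qed.

Lemma sub_conv_hull E : E `<=` conv_hull E.
Proof. by move=> y Ey C _; exact. Qed.

Lemma supp_fun_le E th (c : R) : E !=set0 -> (forall y, E y -> dotv th y <= c) ->
  supp_fun (conv_hull E) th <= c.
Proof.
move=> [y Ey] Ec; apply: ge_sup.
  by exists (dotv th y), y => //; exact: sub_conv_hull.
by move=> _ [z hz <-]; exact: conv_hull_le hz.
Qed.

Lemma supp_fun_ge E th y (B : R) : (forall z, E z -> enorm z <= B) -> E y ->
  dotv th y <= supp_fun (conv_hull E) th.
Proof.
move=> EB Ey; apply: ub_le_sup; last by exists y => //; exact: sub_conv_hull.
exists (enorm th * B) => _ [z hz <-]; apply: conv_hull_le hz => w Ew.
by rewrite (le_trans (cauchy_schwarz _ _))// ler_wpM2l ?enorm_ge0 ?EB.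
Qed.

Lemma enorm_lip_continuous (f : 'rV[R]_n -> R) (B : R) : 0 <= B ->
  (forall u v, f u <= f v + B * enorm (u - v)) -> continuous f.
Proof.
move=> B0 fB u; have FF : Filter (nbhs u) by exact: nbhs_filter.
apply/cvgrPdist_lt => e e0.
have B1 : 0 < B + 1 by rewrite ltr_wpDl.
have eB : 0 < e / (B + 1) by rewrite divr_gt0.
apply: (@filterS _ _ (nbhs_filter u) _ _ _ (nbhs_eball u eB)) => v /=.
rewrite ltr_pdivlMr// => uv.
have h1 := fB u v; have h2 := fB v u; have h3 := enorm_ge0 (v - u).
rewrite enormB in h1; rewrite ltr_norml; apply/andP; split; nra.
Qed.

Lemma continuous_supp_fun E (B : R) : E !=set0 -> 0 <= B ->
  (forall z, E z -> enorm z <= B) -> continuous (supp_fun (conv_hull E)).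
Proof.
move=> E0 B0 EB; apply: (enorm_lip_continuous B0) => u v.
apply: supp_fun_le => // y Ey.
have -> : dotv u y = dotv v y + dotv (u - v) y by rewrite -dotvDl addrC subrK.
apply: lerD; first exact: supp_fun_ge EB Ey.
rewrite mulrC (le_trans (cauchy_schwarz _ _))//.
by rewrite ler_wpM2l ?enorm_ge0 ?EB.
Qed.

Lemma good_supp_fun E (B : R) : E !=set0 -> 0 <= B ->
  (forall z, E z -> enorm z <= B) ->
  good (sphfun (@sphere R n) (supp_fun (conv_hull E))).
Proof.
move=> E0 B0 EB; apply: (good_sphfun (@closed_sphere R n) _ B0).
  exact: continuous_supp_fun EB.
move=> v v1 _; rewrite ler_norml; apply/andP; split.
  have [y Ey] := E0; apply: le_trans (supp_fun_ge v EB Ey).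
  rewrite lerNl -dotvNl (le_trans (cauchy_schwarz _ _))// enormN v1 mul1r.
  exact: EB.
apply: supp_fun_le => // y Ey.
by rewrite (le_trans (cauchy_schwarz _ _))// v1 mul1r EB.
Qed.

End SupportFunction.

(** * Growth of the mean width along the curve *)

Section MeanWidth.
Variables (R : realType) (n : nat) (x : R -> 'rV[R]_n) (L : R).
Notation leb := (@lebesgue_measure R).
Hypothesis n2 : (2 <= n)%N.
Hypothesis arc : arclength_param x L.

Let past s := [set x sig | sig in `[0, s]%classic].
Let h s := supp_fun (conv_hull (past s)).
Let K : R := 2 / @omega R n * n%:R.

Let K_gt0 : 0 < K.
Proof. by apply: mulr_gt0; [rewrite divr_gt0 ?omega_gt0|rewrite ltr0n (leq_trans _ n2)]. Qed.

Let past_bound s z : s <= L -> past s z -> enorm z <= enorm (x 0) + L.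
Proof.
move=> sL [sig + <-]; rewrite /= in_itv/= => /andP[sig0 sigs].
have sigL := le_trans sigs sL.
rewrite -[x sig](subrK (x 0)) addrC; apply: le_trans (enormD _ _) _; apply: lerD => //.
by apply: le_trans (arclength_lip arc (lexx 0) sig0 sigL) _; rewrite subr0.
Qed.

Let past_now s : 0 <= s -> past s (x s).
Proof. by move=> s0; exists s => //; rewrite /= in_itv/= s0 lexx. Qed.

Let h_ge s th sig : 0 <= sig <= s -> s <= L -> dotv th (x sig) <= h s th.
Proof.
move=> ss sL; apply: (supp_fun_ge th (fun z => past_bound sL)).
by exists sig.
Qed.

Let h_le s th c : 0 <= s ->
  (forall sig, 0 <= sig <= s -> dotv th (x sig) <= c) -> h s th <= c.
Proof.
move=> s0 hc; apply: supp_fun_le; first by exists (x s); exact: past_now.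
by move=> _ [sig + <-]; rewrite /= in_itv/=; exact: hc.
Qed.

Let good_h s : 0 <= s <= L -> good (sphfun (@sphere R n) (h s)).
Proof.
move=> /andP[s0 sL]; have L0 := le_trans s0 sL.
apply: (@good_supp_fun R n (past s) (enorm (x 0) + L)).
- by exists (x s); exact: past_now.
- by rewrite addr_ge0 ?enorm_ge0.
- by move=> z; exact: past_bound.
Qed.

Lemma w_gammaE s : 0 <= s <= L ->
  w_gamma x s = K * Iint (sphfun (@sphere R n) (h s)).
Proof.
by move=> ss; rewrite /w_gamma /mean_width sph_integralE ?mulrA//; exact: good_h.
Qed.

(** In a unit direction the support function increases by at most the length t - s of the added arc;
    the factor 2^n is the volume of the enclosing cube. *)
Lemma w_gamma_lip s t : 0 <= s -> s <= t -> t <= L ->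
  `|w_gamma x t - w_gamma x s| <= K * 2 ^+ n * (t - s).
Proof.
move=> s0 st tL; have t0 := le_trans s0 st; have sL := le_trans st tL.
have [gs gt] : good (sphfun (@sphere R n) (h s)) /\ good (sphfun (@sphere R n) (h t)).
  by split; apply: good_h; rewrite ?s0 ?t0.
rewrite !w_gammaE ?s0 ?t0// -mulrBr -IintB// normrM gtr0_norm// -mulrA ler_wpM2l//.
  exact: ltW.
have bnd v : 0 <= sphfun (@sphere R n) (h t) v - sphfun (@sphere R n) (h s) v <=
    (t - s) * \1_(box 0 1) v.
  rewrite /sphfun !indicE.
  case: (boolP (v \in cone1 (@sphere R n))) => [/set_mem cv|_]; last first.
    by rewrite !mul0r subrr lexx/= mulr_ge0// subr_ge0.
  rewrite (_ : v \in box _ _ = true); last exact/mem_set/(cone1_box cv).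
  rewrite !mul1r mulr1; case: cv => _; set th := _ *: v => th1.
  rewrite subr_ge0 lerBlDl; apply/andP; split.
    apply: h_le => // sig /andP[sig0 sigs].
    by apply: h_ge => //; rewrite sig0 (le_trans sigs).
  apply: h_le => // sig /andP[sig0 sigt].
  have [sigs|/ltW ssig] := leP sig s.
    apply: (@le_trans _ _ (h s th)); first by apply: h_ge => //; rewrite sig0.
    by rewrite lerDl subr_ge0.
  have -> : dotv th (x sig) = dotv th (x s) + dotv th (x sig - x s).
    by rewrite -dotvDr addrC subrK.
  apply: lerD; first by apply: h_ge => //; rewrite s0 lexx.
  apply: le_trans (cauchy_schwarz _ _) _; rewrite (th1 : enorm th = 1) mul1r.
  by apply: le_trans (arclength_lip arc s0 ssig (le_trans sigt tL)) _; rewrite lerD2r.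
have gB := goodB gt gs.
rewrite ger0_norm; last first.
  rewrite -(Iint0 R n); apply: le_Iint => //; first exact: good0.
  by move=> v; case/andP : (bnd v).
rewrite mulrC -[2]mulr1 -(Iint_box (0 : 'rV[R]_n) ler01) -IintZ; last exact: good_indic_box.
apply: le_Iint => //; first exact/goodZ/good_indic_box.
by move=> v; case/andP : (bnd v).
Qed.

(** Stating the bound for finite increments avoids differentiating support functions under the
    integral. On the normal sector the support function at time s is attained at [x s]. *)
Lemma w_gamma_increment s d : 0 <= s -> 0 <= d -> s + d <= L ->
  K * moment (polar_sector [set x s - x sig | sig in `[0, s]%classic])
    (x (s + d) - x s) <= w_gamma x (s + d) - w_gamma x s.
Proof.
move=> s0 d0 sdL; have sd0 : 0 <= s + d by rewrite addr_ge0.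
have sL : s <= L by apply: le_trans sdL; rewrite lerDl.
have [gs gt] : good (sphfun (@sphere R n) (h s)) /\
    good (sphfun (@sphere R n) (h (s + d))).
  by split; apply: good_h; rewrite ?s0 ?sd0.
rewrite !w_gammaE ?s0 ?sd0// -mulrBr -IintB// ler_wpM2l ?(ltW K_gt0)//.
set S := polar_sector _; have cS : closed S by exact: closed_polar_sector.
apply: le_Iint; [exact: good_moment|exact: goodB|].
move=> v; rewrite /sphfun !indicE.
have mono th : h s th <= h (s + d) th.
  apply: h_le => // sig /andP[sig0 sigs].
  by apply: h_ge => //; rewrite sig0 (le_trans sigs)// lerDl.
case: (boolP (v \in cone1 S)) => [/set_mem [v0 [Sv v1]]|_].
  rewrite (_ : v \in cone1 (@sphere R n) = true); last by apply/mem_set; split.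
  rewrite !mul1r; set th := _ *: v in Sv v1 *.
  have hs : h s th <= dotv th (x s).
    apply: h_le => // sig ss; rewrite -subr_ge0 -dotvBr; apply: Sv.
    by exists sig.
  have hd : dotv th (x (s + d)) <= h (s + d) th.
    by apply: h_ge => //; rewrite sd0 lexx.
  by rewrite dotvBr; lra.
by rewrite mul0r -mulrBr mulr_ge0// subr_ge0.
Qed.

(** Left difference quotients are positive multiples of chords to the past, and these pair
    nonnegatively with the sector by its definition. *)
Lemma derive_in_dual s : 0 < s <= L -> derivable x s 1 -> enorm (derive1 x s) = 1 ->
  dual_sector (polar_sector [set x s - x sig | sig in `[0, s]%classic]) (derive1 x s).
Proof.
move=> /andP[s0 sL] dx u1; split => // th [hth _]; rewrite dotvC.
have dth := is_derive_dotv dx th.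
have cv : (fun d : R => d^-1 *: (dotv th (x (d *: 1 + s)) - dotv th (x s))) @ 0^' -->
    dotv th (derive1 x s).
  by have <- := @derive_val _ _ _ _ _ _ _ dth; exact: (@ex_derive _ _ _ _ _ _ _ dth).
have /cvgr_to_ge := cvg_dnbhs_at_left cv.
apply; near=> d.
have d0 : d < 0 by near: d; exact: nbhs_left_lt.
have ds : - s < d by near: d; apply: nbhs_left_gt; rewrite oppr_lt0.
have /hth : [set x s - x sig | sig in `[0, s]%classic] (x s - x (d *: 1 + s)).
  exists (d *: 1 + s) => //; rewrite /= in_itv/= /GRing.scale/= mulr1.
  by apply/andP; split; lra.
rewrite dotvBr -opprB /GRing.scale/= => hh.
by rewrite nmulr_rge0 ?invr_lt0//; lra.
Unshelve. all: by end_near. Qed.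

Lemma derive_w_gamma_ge s : 0 < s < L -> derivable x s 1 ->
  derivable (w_gamma x) s 1 ->
  K * moment (polar_sector [set x s - x sig | sig in `[0, s]%classic])
    (derive1 x s) <= derive1 (w_gamma x) s.
Proof.
move=> /andP[s0 sL] dx dw; set S := polar_sector _.
have cS : closed S by exact: closed_polar_sector.
pose q (d : R) := d^-1 *: (x (d *: 1 + s) - x s).
have cq : q d @[d --> 0^'+] --> derive1 x s.
  by rewrite derive1E; exact: cvg_dnbhs_at_right dx.
have cw : d^-1 *: (w_gamma x (d *: 1 + s) - w_gamma x s) @[d --> 0^'+] -->
    derive1 (w_gamma x) s.
  by rewrite derive1E; exact: cvg_dnbhs_at_right dw.
have ce : enorm (q d - derive1 x s) @[d --> 0^'+] -->
    enorm (derive1 x s - derive1 x s).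
  exact: (cvg_comp _ _ cq (@continuous_enormB R n (derive1 x s) (derive1 x s))).
rewrite subrr enorm0 in ce.
(* A lower bound for the moment at the right difference quotient [q d], by linearity and
   [le_moment_norm]. *)
have cl : K * (moment S (derive1 x s) - 2 ^+ n * enorm (q d - derive1 x s))
    @[d --> 0^'+] --> K * moment S (derive1 x s).
  rewrite -[X in _ --> K * X]subr0 -[X in _ - X](mulr0 (2 ^+ n)).
  by apply: cvgMr; apply: cvgB; [exact: cvg_cst|exact: cvgMr].
apply: (ler_cvg_to cl cw); near=> d.
have d0 : 0 < d by near: d; exact: nbhs_right_gt.
have dL : d < L - s by near: d; apply: nbhs_right_lt; rewrite subr_gt0.
apply: (@le_trans _ _ (K * moment S (q d))).
  rewrite ler_wpM2l ?(ltW K_gt0)// lerBlDl addrC -lerBlDl -momentB// enormB.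
  exact: le_moment_norm.
have sdL : s + d <= L by lra.
have inc := w_gamma_increment (ltW s0) (ltW d0) sdL.
rewrite -/S [s + d]addrC in inc.
have -> : d *: 1 + s = d + s by rewrite /GRing.scale/= mulr1.
rewrite /q momentZ// mulrCA.
have -> : d *: 1 + s = d + s by rewrite /GRing.scale/= mulr1.
by rewrite [leRHS]/GRing.scale/= ler_wpM2l ?invr_ge0 ?(ltW d0).
Unshelve. all: by end_near. Qed.

End MeanWidth.

Theorem theorem5p1 (R : realType) (n : nat) (x : R -> 'rV[R]_n) (L : R) :
  (2 <= n)%N -> in_Gamma x L ->
  exists (S0 : set 'rV[R]_n) (u0 : 'rV[R]_n),
    [/\ classC S0, dual_sector S0 u0,
        (forall (S : set 'rV[R]_n) (u : 'rV[R]_n), classC S -> dual_sector S u -> Phi S0 u0 <= Phi S u),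
        0 < Phi S0 u0 &
        {ae @lebesgue_measure R, forall s, 0 <= s <= L ->
           derivable (w_gamma x) s 1 /\ Phi S0 u0 <= derive1 (w_gamma x) s}].
Proof.
move=> n2 [L0 [arc steep]].
have [S0 [u0 [C0 D0 min0 pos0]]] := Phi_minimizer R n2.
exists S0, u0; split => //.
set leb := @lebesgue_measure R; have aeF := ae_filter_ringOfSetsType leb.
have open_steep : {ae leb, forall s, 0 < s < L -> derivable x s 1 /\
    forall sig, 0 <= sig <= s -> 0 <= dotv (derive1 x s) (x s - x sig)}.
  apply: (@filterS _ _ aeF _ _ _ steep) => s hs /andP[s0 sL].
  by apply: hs; rewrite !ltW.
have unit1 : {ae leb, forall s, 0 < s < L -> enorm (derive1 x s) = 1}.
  apply: (unit_speed arc); apply: (@filterS _ _ aeF _ _ _ open_steep) => s hs sL.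
  by case: (hs sL).
(* Nothing is known about x outside [0, L], so both endpoints are discarded as null sets. *)
have not_end c : {ae leb, forall s, s != c}.
  by exists [set c]; split => //; [exact: lebesgue_measure_set1|move=> u /=; case: eqP].
have dw : {ae leb, forall s, 0 < s < L -> derivable (w_gamma x) s 1}.
  have [L00|Lpos] := leP L 0.
    apply: aeW => s /andP[s0 sL].
    by exfalso; have := lt_le_trans (lt_trans s0 sL) L00; rewrite ltxx.
  have K0 : 0 <= 2 / @omega R n * n%:R * 2 ^+ n.
    by rewrite mulr_ge0 ?exprn_ge0// mulr_ge0// divr_ge0// ltW// omega_gt0.
  have [phi [_ _]] := lip_density Lpos K0 (w_gamma_lip n2 arc).
  move=> hphi; apply: (@filterS _ _ aeF _ _ _ hphi) => s hs sL.
  by case: (hs sL).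
apply: (@filterS _ _ aeF _ _ _ (@filterI _ _ aeF _ _ (not_end 0) (@filterI _ _ aeF _ _
  (not_end L) (@filterI _ _ aeF _ _ open_steep (@filterI _ _ aeF _ _ unit1 dw))))).
move=> s [s0 [sL [hs [us ds]]]] /andP[s0' sL'].
have sI : 0 < s < L by rewrite !lt_neqAle s0' sL' sL eq_sym s0.
have [dx _] := hs sI; have ws := ds sI; split => //.
apply: le_trans (derive_w_gamma_ge n2 arc sI dx ws).
set S := polar_sector _.
have CS : classC S.
  by apply: polar_sector_classC; apply: (acute_past arc open_steep); rewrite s0'.
have Du : dual_sector S (derive1 x s).
  have s0L : 0 < s <= L by case/andP : sI => ->.
  exact: derive_in_dual s0L dx (us sI).
by have := min0 _ _ CS Du; rewrite (PhiE _ (classC_closed CS)).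
Qed.
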